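(* Let $\mathbf{g}=(E,V,r,s)$ be a directed graph such that $r$ is onto and $s^{-1}(v)$ is nonempty and finite for every $v\in V$. The map $j:G(\mathbf{g})\to G_m(\Gamma(\mathbf{g}))$, $j((x,k,y))=[\{((x_1,\ldots,x_n),(y_1,\ldots,y_{n+k})):n\ge N(x,y)\}]$, is an isomorphism of topological groupoids.
   Context: Graph: $E$ is the set of edges, $V$ the set of vertices, $r,s:E\to V$ range and source. A path of length $n\ge1$ is $\alpha=(\alpha_1,\ldots,\alpha_n)\in E^n$ with $s(\alpha_{j+1})=r(\alpha_j)$; $s(\alpha)=s(\alpha_1)$, $r(\alpha)=r(\alpha_n)$, $|\alpha|=n$. Paths of length $0$ are vertices $v$, with $r(v)=s(v)=v$. $F(\mathbf{g})$ is the set of finite paths (including length $0$), $P(\mathbf{g})$ the set of infinite paths $(\alpha_1,\alpha_2,\ldots)$. Concatenation $\alpha\mu$ is defined if $r(\alpha)=s(\mu)$, with length-$0$ paths acting as identities. Here $\alpha\prec\beta$ for paths means $\beta=\alpha\mu$ for some $\mu$ (so $\alpha$ is an initial segment of $\beta$). $\Gamma(\mathbf{g})=\{(\alpha,\beta)\in F(\mathbf{g})\times F(\mathbf{g}):r(\alpha)=r(\beta)\}\cup\{0\}$ with $(\alpha,\beta)(\beta\mu,\delta)=(\alpha\mu,\delta)$, $(\alpha,\gamma\mu)(\gamma,\delta)=(\alpha,\delta\mu)$ ($\mu$ possibly of length $0$), all other products $0$; it is an inverse semigroup with zero and $(\alpha,\beta)^{-1}=(\beta,\alpha)$. $G(\mathbf{g})$: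 for $x,y\in P(\mathbf{g})$ and $k\in\mathbb{Z}$ write $x\sim_k y$ if there is $N(x,y)\in\mathbb{N}$ with $x_i=y_{i+k}$ for all $i\ge N(x,y)$ (choose $N(x,y)$ so that also $N(x,y)\ge1$ and $N(x,y)+k\ge1$). $G(\mathbf{g})=\{(x,k,y)\in P(\mathbf{g})\times\mathbb{Z}\times P(\mathbf{g}):x\sim_k y\}$, with $(x,k,y)(y,l,z)=(x,k+l,z)$ (only such pairs composable) and $(x,k,y)^{-1}=(y,-k,x)$. A basis of its topology is given by the sets $Z(\alpha,\beta)=\{(x,k,y)\in G(\mathbf{g}):\alpha\prec x,\ \beta\prec y,\ k=|\beta|-|\alpha|,\ x_i=y_{i+k}\text{ for } i>|\alpha|\}$ with $\alpha,\beta\in F(\mathbf{g})$, $r(\alpha)=r(\beta)$. $G_m(\Gamma)$ for an inverse semigroup $\Gamma$: $x\prec y$ means $xy^{-1}=xx^{-1}$. $0$ denotes the least element, if it exists; an element $x$ is minimal if $x\ne0$ and $y\prec x$, $y\neq0$ implies $y=x$. A subset $A\subset\Gamma$ is directed if it is nonempty and any two elements of $A$ have a common $\prec$-lower bound in $A$. For directed sets $A\prec B$ means that for every $b\in B$ there is $a\in A$ with $a\prec b$; $A\sim B$ means $A\prec B$ and $B\prec A$. $\mathcal{O}(\Gamma)$ is the set of $\sim$-classes $[A]$; with $[A][B]=[AB]$, $[A]^{-1}=[A^{-1}]$ it is an inverse semigroup with natural order $[A]\prec[B]\iff A\prec B$. $G_u(\Gamma)$ is the groupoid with set $\mathcal{O}(\Gamma)$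 and product $XY$ defined iff $X^{-1}X=YY^{-1}$; with $U_x=\{X:X\prec[\{x\}]\}$, its topology has basis $U_x\cap U_{x_1}^c\cap\cdots\cap U_{x_n}^c$ ($x_1,\ldots,x_n\prec x$ in $\Gamma$, $n\ge0$). $G_m(\Gamma)$ is the subgroupoid of minimal elements of $\mathcal{O}(\Gamma)$ with the subspace topology. *)

(* Defs.v *)
From HB Require Import structures.
From mathcomp Require Import all_boot all_order all_algebra.
From mathcomp Require Import all_classical topology zify.
Set Implicit Arguments.
Unset Strict Implicit.
Unset Printing Implicit Defensive.

Local Open Scope classical_set_scope.
Local Open Scope quotient_scope.
Local Open Scope group_scope.

HB.mixin Record Semigroup_isInvSemigroup S & Semigroup S := {
  sinv : S -> S;
  mulsVs : forall x : S, x * sinv x * x = x;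
  mulVsV : forall x : S, sinv x * x * sinv x = sinv x;
  sinv_uniq : forall x y : S, x * y * x = x -> y * x * y = y -> y = sinv x
}.

#[short(type="invSemigroupType")]
HB.structure Definition InvSemigroup :=
  {S of Semigroup_isInvSemigroup S & Semigroup S}.

(* The inverse in an inverse semigroup is written x^*, since x^-1 is notation for
   structures that have a unit. *)
Notation "x ^*" := (sinv x) : group_scope.

(* An involutive anti-automorphism i with x (i x) x = x and commuting projections
   x (i x) gives the unique inverses. *)
Section FromEquations.
Variables (S : semigroupType) (i : S -> S).
Hypothesis mulsis : forall x, x * i x * x = x.
Hypothesis iK : involutive i.
Hypothesis iM : forall x y, i (x * y) = i y * i x.
Hypothesis projC : forall x y, (x * i x) * (y * i y) = (y * i y) * (x * i x).

Lemma eqn_inv_uniq x y : x * y * x = x -> y * x * y = y -> y = i x.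
Proof.
have isi z : i z * z * i z = i z by have := mulsis (i z); rewrite iK.
have ieq (e : S) : e * e = e -> e = e * i e.
  move=> ee.
  have iee : i e * i e = i e by rewrite -iM ee.
  have -> : i e = e.
    have := projC e (i e); rewrite iK => pc.
    have -> : i e = (i e * e) * (e * i e).
      by rewrite -{1}isi -{2}ee !mulgA.
    rewrite -pc.
    have -> : e * i e * (i e * e) = e * (i e * i e) * e by rewrite !mulgA.
    by rewrite iee mulsis.
  by rewrite ee.
have idC (e f : S) : e * e = e -> f * f = f -> e * f = f * e.
  by move=> ee ff; have := projC e f; rewrite -(ieq _ ee) -(ieq _ ff).
move=> xyx yxy.
have c1 : (y * x) * (i x * x) = (i x * x) * (y * x).
  by apply: idC; rewrite mulgA ?yxy ?isi.
have c2 : (x * i x) * (x * y) = (x * y) * (x * i x).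
  by apply: idC; rewrite mulgA ?xyx ?mulsis.
have -> : y = i x * x * y.
  rewrite -{1}yxy -{1}(mulsis x) -[y * (_ * x)]/(_).
  have -> : y * (x * i x * x) * y = (y * x) * (i x * x) * y by rewrite !mulgA.
  by rewrite c1 -!mulgA; congr (_ * (_ * _)); rewrite mulgA.
rewrite -{1}(isi x) -[_ * x * y]mulgA.
have -> : i x * x * i x * (x * y) = i x * ((x * i x) * (x * y)) by rewrite !mulgA.
by rewrite c2 [x * y * _]mulgA xyx mulgA isi.
Qed.

End FromEquations.

Section InvSemigroupTheory.
Variable S : invSemigroupType.
Implicit Types x y z e f : S.

Definition natle x y := x * y^* = x * x^*.

(* being the least element, that is the zero, of the natural order *)
Definition is_least x := forall y, natle x y.

Definition is_minimal x :=
  ~ is_least x /\ forall y, natle y x -> ~ is_least y -> y = x.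

Lemma sinvK : involutive (@sinv S).
Proof. by move=> x; apply/esym/sinv_uniq; [exact: mulVsV|exact: mulsVs]. Qed.

Lemma sinv_idem e : e * e = e -> e^* = e.
Proof. by move=> ee; apply/esym/sinv_uniq; rewrite !ee. Qed.

Lemma idemM e f : e * e = e -> f * f = f -> (e * f) * (e * f) = e * f.
Proof.
move=> ee ff; set a := (e * f)^*.
have h1 : e * f * a * (e * f) = e * f by exact: mulsVs.
have h2 : a * (e * f) * a = a by exact: mulVsV.
have ea : f * a * e = a.
  apply: sinv_uniq.
    have -> : e * f * (f * a * e) * (e * f) = e * (f * f) * a * (e * e) * f.
      by rewrite !mulgA.
    by rewrite ee ff -{2}h1 !mulgA.
  have -> : f * a * e * (e * f) * (f * a * e) = f * (a * ((e * e) * (f * f)) * a) * e.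
    by rewrite !mulgA.
  by rewrite ee ff h2.
have aa : a * a = a.
  rewrite -{1 2}ea.
  have -> : f * a * e * (f * a * e) = f * (a * (e * f) * a) * e by rewrite !mulgA.
  by rewrite h2.
by rewrite -(sinvK (e * f)) -/a (sinv_idem aa).
Qed.

Lemma idemC e f : e * e = e -> f * f = f -> e * f = f * e.
Proof.
move=> ee ff; rewrite -(sinv_idem (idemM ff ee)).
apply: sinv_uniq.
  have -> : f * e * (e * f) * (f * e) = f * (e * e) * (f * f) * e by rewrite !mulgA.
  rewrite ee ff -[RHS](idemM ff ee) !mulgA //.
have -> : e * f * (f * e) * (e * f) = e * (f * f) * (e * e) * f by rewrite !mulgA.
rewrite ee ff -[RHS](idemM ee ff) !mulgA //.
Qed.

Lemma idem_sV x : (x * x^*) * (x * x^*) = x * x^*.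
Proof. by rewrite mulgA mulsVs. Qed.

Lemma idem_Vs x : (x^* * x) * (x^* * x) = x^* * x.
Proof. by rewrite mulgA mulVsV. Qed.

Lemma sinvM x y : (x * y)^* = y^* * x^*.
Proof.
apply/esym/sinv_uniq.
  have -> : x * y * (y^* * x^*) * (x * y) = x * ((y * y^*) * (x^* * x)) * y.
    by rewrite !mulgA.
  rewrite (idemC (idem_sV y) (idem_Vs x)).
  have -> : x * (x^* * x * (y * y^*)) * y = (x * x^* * x) * (y * y^* * y).
    by rewrite !mulgA.
  by rewrite !mulsVs.
have -> : y^* * x^* * (x * y) * (y^* * x^*) =
    y^* * ((x^* * x) * (y * y^*)) * x^* by rewrite !mulgA.
rewrite -(idemC (idem_sV y) (idem_Vs x)).
have -> : y^* * (y * y^* * (x^* * x)) * x^* =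
    (y^* * y * y^*) * (x^* * x * x^*) by rewrite !mulgA.
by rewrite !mulVsV.
Qed.

Lemma idem_conj x e : e * e = e -> (x * e * x^*) * (x * e * x^*) = x * e * x^*.
Proof.
move=> ee.
have -> : x * e * x^* * (x * e * x^*) = x * (e * (x^* * x)) * e * x^*.
  by rewrite !mulgA.
rewrite (idemC ee (idem_Vs x)).
have -> : x * (x^* * x * e) * e * x^* = (x * x^* * x) * (e * e) * x^*.
  by rewrite !mulgA.
by rewrite ee mulsVs.
Qed.

Lemma mulse_conj x e : e * e = e -> x * e = x * e * x^* * x.
Proof.
move=> ee.
have -> : x * e * x^* * x = x * (e * (x^* * x)) by rewrite !mulgA.
by rewrite (idemC ee (idem_Vs x)) !mulgA mulsVs.
Qed.

Lemma natle_mull e y : e * e = e -> natle (e * y) y.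
Proof.
move=> ee; rewrite /natle sinvM (sinv_idem ee).
have -> : e * y * (y^* * e) = e * ((y * y^*) * e) by rewrite !mulgA.
by rewrite (idemC (idem_sV y) ee) !mulgA ee.
Qed.

Lemma natle_mulr e y : e * e = e -> natle (y * e) y.
Proof. by move=> ee; rewrite (mulse_conj _ ee); apply/natle_mull/idem_conj. Qed.

Lemma natle_eqr x y : natle x y -> x = y * (x^* * x).
Proof.
move=> h; have h' : y * x^* = x * x^*.
  have /(congr1 (@sinv S)) := h; rewrite !sinvM !sinvK => ->.
  by [].
by rewrite mulgA h' mulsVs.
Qed.

Lemma natle_eql x y : natle x y -> x = x * x^* * y.
Proof.
move=> h; have h' : y * x^* = x * x^*.
  by have /(congr1 (@sinv S)) := h; rewrite !sinvM !sinvK.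
have := natle_eqr h; rewrite (mulse_conj y (idem_Vs x)).
have -> : y * (x^* * x) * y^* * y = y * x^* * (x * y^*) * y by rewrite !mulgA.
by rewrite h h' idem_sV.
Qed.

Lemma natle_refl x : natle x x. Proof. by []. Qed.

Lemma natle_anti x y : natle x y -> natle y x -> x = y.
Proof.
move=> xy yx; have e : x * x^* = y * y^*.
  by have /(congr1 (@sinv S)) := xy; rewrite !sinvM !sinvK yx => ->.
by rewrite (natle_eql xy) e mulsVs.
Qed.

Lemma natle_trans y x z : natle x y -> natle y z -> natle x z.
Proof.
move=> /natle_eql -> /natle_eql {1}->; rewrite mulgA.
by apply/natle_mull/idemM; exact: idem_sV.
Qed.

Lemma natle_mul x x' y y' : natle x x' -> natle y y' -> natle (x * y) (x' * y').
Proof.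
move=> /natle_eql -> /natle_eqr ->.
have -> : x * x^* * x' * (y' * (y^* * y)) = x * x^* * (x' * y' * (y^* * y)).
  by rewrite !mulgA.
apply: (@natle_trans (x' * y' * (y^* * y))).
  exact: natle_mull (idem_sV x).
exact: natle_mulr (idem_Vs y).
Qed.

Lemma natle_inv x y : natle x y -> natle x^* y^*.
Proof.
move=> /natle_eql ->; rewrite sinvM (sinv_idem (idem_sV x)).
exact: natle_mulr (idem_sV x).
Qed.

Lemma natle_inv_eq x y : natle x^* y^* -> natle x y.
Proof. by move=> /natle_inv; rewrite !sinvK. Qed.

Lemma minimal_inv x : is_minimal x -> is_minimal x^*.
Proof.
case=> nx mx; split; first by move=> lx; apply: nx => y; apply/natle_inv_eq/lx.
move=> y /natle_inv; rewrite sinvK => yx ny; rewrite -(sinvK y); congr (_^*).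
by apply: mx => // ly; apply: ny => z; apply/natle_inv_eq/ly.
Qed.

Lemma least_mulr x y : is_least x -> is_least (x * y).
Proof.
move=> lx z; apply: (@natle_trans (z * y^* * y)).
  exact: natle_mul.
by rewrite -mulgA; apply: natle_mulr (idem_Vs y).
Qed.

Lemma minimal_mul x y :
  x^* * x = y * y^* -> is_minimal x -> is_minimal y -> is_minimal (x * y).
Proof.
move=> xy [nx mx] _.
have xyV : x * y * y^* = x by rewrite -mulgA -xy mulgA mulsVs.
split; first by move=> /least_mulr-/(_ y^*); rewrite xyV.
move=> z zxy nz.
have zVy : z * y^* * y = z.
  rewrite {1}(natle_eql zxy).
  have -> : z * z^* * (x * y) * y^* * y = z * z^* * (x * (y * y^* * y)).
    by rewrite !mulgA.
  by rewrite mulsVs -natle_eql.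
rewrite -zVy; congr (_ * _); apply: mx.
  by rewrite -xyV; apply: natle_mul.
by move=> /least_mulr-/(_ y); rewrite zVy.
Qed.

Definition directed (A : set S) :=
  A !=set0 /\ forall a b, A a -> A b -> exists c, [/\ A c, natle c a & natle c b].

Definition setle (A B : set S) := forall b, B b -> exists2 a, A a & natle a b.

Lemma setle_refl A : setle A A. Proof. by move=> a Aa; exists a. Qed.

Lemma setle_trans B A C : setle A B -> setle B C -> setle A C.
Proof.
move=> AB BC c /BC[b /AB[a Aa ab] bc]; exists a => //; exact: natle_trans bc.
Qed.

Definition set_mulS (A B : set S) : set S := [set a * b | a in A & b in B].
Definition set_invS (A : set S) : set S := [set a^* | a in A].

Lemma setle_mul A A' B B' :
  setle A A' -> setle B B' -> setle (set_mulS A B) (set_mulS A' B').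
Proof.
move=> AA BB _ [a' /AA[a Aa aa] [b' /BB[b Bb bb] <-]].
by exists (a * b); [exists a => //; exists b|exact: natle_mul].
Qed.

Lemma setle_inv A B : setle A B -> setle (set_invS A) (set_invS B).
Proof.
move=> AB _ [b /AB[a Aa ab] <-]; exists a^*; first by exists a.
exact: natle_inv.
Qed.

Lemma directed1 x : directed [set x].
Proof. by split=> [|_ _ -> ->]; exists x. Qed.

Lemma directed_mul A B : directed A -> directed B -> directed (set_mulS A B).
Proof.
move=> [[a0 Aa0] dA] [[b0 Bb0] dB]; split.
  by exists (a0 * b0), a0 => //; exists b0.
move=> _ _ [a Aa [b Bb <-]] [a' Aa' [b' Bb' <-]].
have [c [Ac ca ca']] := dA _ _ Aa Aa'; have [d [Bd db db']] := dB _ _ Bb Bb'.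
exists (c * d); split; [by exists c => //; exists d|exact: natle_mul..].
Qed.

Lemma directed_inv A : directed A -> directed (set_invS A).
Proof.
move=> [[a0 Aa0] dA]; split; first by exists a0^*, a0.
move=> _ _ [a Aa <-] [b Ab <-]; have [c [Ac ca cb]] := dA _ _ Aa Ab.
by exists c^*; split; [exists c|exact: natle_inv..].
Qed.

Record dirset := DirSet { dset :> set S; dsetP : directed dset }.

Lemma dirset_eq (A B : dirset) : dset A = dset B -> A = B.
Proof.
case: A B => [A dA] [B dB] /= AB; case: _ / AB in dB *.
by congr DirSet; exact: Prop_irrelevance.
Qed.

HB.instance Definition _ := gen_eqMixin dirset.
HB.instance Definition _ := gen_choiceMixin dirset.

(* A ~ B *)
Definition dirset_eqv (A B : dirset) : bool := `[< setle A B /\ setle B A >].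

Lemma dirset_eqv_refl : reflexive dirset_eqv.
Proof. by move=> A; apply/asboolP; split; exact: setle_refl. Qed.

Lemma dirset_eqv_sym : symmetric dirset_eqv.
Proof. by move=> A B; apply/asboolP/asboolP => -[]; split. Qed.

Lemma dirset_eqv_trans : transitive dirset_eqv.
Proof.
move=> B A C /asboolP[AB BA] /asboolP[BC CB]; apply/asboolP.
by split; [exact: setle_trans BC|exact: setle_trans BA].
Qed.

Canonical dirset_equiv :=
  EquivRel dirset_eqv dirset_eqv_refl dirset_eqv_sym dirset_eqv_trans.

(* the semigroup O(S) of ~-classes; dcls dA below is the class [A] *)
Definition dirclass := {eq_quot dirset_equiv}.

HB.instance Definition _ := Choice.on dirclass.
HB.instance Definition _ := Quotient.on dirclass.

Definition dcls (A : set S) (dA : directed A) : dirclass := \pi_dirclass (DirSet dA).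

Lemma dclsP A dA B dB :
  @dcls A dA = @dcls B dB <-> setle A B /\ setle B A.
Proof.
split; first by move=> /eqmodP/asboolP.
by move=> AB; apply/eqmodP/asboolP.
Qed.

Lemma dclsW (P : dirclass -> Prop) :
  (forall A (dA : directed A), P (dcls dA)) -> forall X, P X.
Proof. by move=> PA; elim/quotW => -[A dA]; apply: PA. Qed.

Definition dcls_mul (X Y : dirclass) : dirclass :=
  dcls (directed_mul (dsetP (repr X)) (dsetP (repr Y))).

Definition dcls_inv (X : dirclass) : dirclass := dcls (directed_inv (dsetP (repr X))).

Lemma repr_dcls A (dA : directed A) :
  setle (repr (dcls dA)) A /\ setle A (repr (dcls dA)).
Proof.
have : dcls (dsetP (repr (dcls dA))) = dcls dA.
  rewrite -[RHS]reprK /dcls; congr (\pi_dirclass _); exact: dirset_eq.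
by move=> /dclsP.
Qed.

Lemma dcls_mulE A dA B dB :
  dcls_mul (@dcls A dA) (@dcls B dB) = dcls (directed_mul dA dB).
Proof.
apply/dclsP; have [A1 A2] := repr_dcls dA; have [B1 B2] := repr_dcls dB.
by split; apply: setle_mul.
Qed.

Lemma dcls_invE A dA : dcls_inv (@dcls A dA) = dcls (directed_inv dA).
Proof. by apply/dclsP; have [A1 A2] := repr_dcls dA; split; apply: setle_inv. Qed.

Lemma dcls_eq A dA B dB : A = B -> @dcls A dA = @dcls B dB.
Proof. by move=> AB; apply/dclsP; rewrite AB; split; exact: setle_refl. Qed.

Lemma dcls_mulA : associative dcls_mul.
Proof.
elim/dclsW=> A dA; elim/dclsW => B dB; elim/dclsW => C dC.
rewrite !dcls_mulE; apply: dcls_eq; apply/seteqP; split=> [x|x].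
  move=> [a Aa [_ [b Bb [c Cc <-]] <-]]; rewrite mulgA.
  by exists (a * b); [exists a => //; exists b|exists c].
move=> [_ [a Aa [b Bb <-]] [c Cc <-]]; rewrite -mulgA.
by exists a => //; exists (b * c) => //; exists b => //; exists c.
Qed.

HB.instance Definition _ := isSemigroup.Build dirclass dcls_mulA.

Lemma mul_dcls A dA B dB :
  @dcls A dA * @dcls B dB = dcls (directed_mul dA dB).
Proof. exact: dcls_mulE. Qed.

Lemma dcls_mulVs (X : dirclass) : X * dcls_inv X * X = X.
Proof.
elim/dclsW: X => A dA; rewrite dcls_invE !mul_dcls; apply/dclsP; split.
  move=> a Aa; exists (a * a^* * a); last by rewrite mulsVs.
  by exists (a * a^*); [exists a => //; exists a^* => //; exists a|exists a].
move=> _ [_ [a Aa [_ [b Ab <-] <-]] [c Ac <-]].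
case: dA => _ dA; have [d [Ad da db]] := dA _ _ Aa Ab.
have [e [Ae ed ec]] := dA _ _ Ad Ac; exists e => //.
rewrite -{1}(mulsVs e); apply: natle_mul => //; apply: natle_mul.
  exact: natle_trans da.
by apply: natle_inv; exact: natle_trans db.
Qed.

Lemma dcls_invK : involutive dcls_inv.
Proof.
elim/dclsW=> A dA; rewrite !dcls_invE; apply: dcls_eq; apply/seteqP; split=> x.
  by move=> [_ [a Aa <-] <-]; rewrite sinvK.
by move=> Ax; exists x^*; rewrite ?sinvK //; exists x.
Qed.

Lemma dcls_invM (X Y : dirclass) : dcls_inv (X * Y) = dcls_inv Y * dcls_inv X.
Proof.
elim/dclsW: X => A dA; elim/dclsW: Y => B dB.
rewrite mul_dcls !dcls_invE mul_dcls; apply: dcls_eq.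
apply/seteqP; split=> x.
  move=> [_ [a Aa [b Bb <-]] <-]; rewrite sinvM.
  by exists b^*; [exists b|exists a^* => //; exists a].
move=> [_ [b Bb <-] [_ [a Aa <-] <-]]; rewrite -sinvM.
by exists (a * b) => //; exists a => //; exists b.
Qed.

Lemma dcls_projC (X Y : dirclass) :
  (X * dcls_inv X) * (Y * dcls_inv Y) = (Y * dcls_inv Y) * (X * dcls_inv X).
Proof.
elim/dclsW: X => A dA; elim/dclsW: Y => B dB.
rewrite !dcls_invE !mul_dcls.
have key (C D : set S) (hC : directed C) (hD : directed D) :
    setle (set_mulS (set_mulS C (set_invS C)) (set_mulS D (set_invS D)))
          (set_mulS (set_mulS D (set_invS D)) (set_mulS C (set_invS C))).
  case: hC hD => [_ dC] [_ dD]; move=> _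
    [_ [d Dd [_ [d' Dd' <-] <-]] [_ [c Cc [_ [c' Cc' <-] <-]] <-]].
  have [c2 [Cc2 c2c c2c']] := dC _ _ Cc Cc'.
  have [d2 [Dd2 d2d d2d']] := dD _ _ Dd Dd'.
  exists ((c2 * c2^*) * (d2 * d2^*)).
    by exists (c2 * c2^*); [exists c2 => //; exists c2^* => //; exists c2|
      exists (d2 * d2^*) => //; exists d2 => //; exists d2^* => //; exists d2].
  rewrite (idemC (idem_sV c2) (idem_sV d2)).
  by apply: natle_mul; apply: natle_mul => //; exact: natle_inv.
by apply/dclsP; split; exact: key.
Qed.

Lemma dcls_inv_uniq (X Y : dirclass) :
  X * Y * X = X -> Y * X * Y = Y -> Y = dcls_inv X.
Proof. exact: eqn_inv_uniq dcls_mulVs dcls_invK dcls_invM dcls_projC _ _. Qed.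

Lemma dcls_VsV (X : dirclass) : dcls_inv X * X * dcls_inv X = dcls_inv X.
Proof. by have := dcls_mulVs (dcls_inv X); rewrite dcls_invK. Qed.

HB.instance Definition _ := Semigroup_isInvSemigroup.Build dirclass
  dcls_mulVs dcls_VsV dcls_inv_uniq.

Lemma sinv_dcls A dA : (@dcls A dA)^* = dcls (directed_inv dA).
Proof. exact: dcls_invE. Qed.

End InvSemigroupTheory.

(* the natural order of O(S) is [A] < [B] iff setle A B *)
Lemma natle_dcls (S : invSemigroupType) (A B : set S) dA dB :
  natle (@dcls S A dA) (@dcls S B dB) <-> setle A B.
Proof.
rewrite /natle !sinv_dcls !mul_dcls; split.
  case/dclsP => AB AA b Bb; have [[a Aa] dA'] := dA.
  have [_ [a1 Aa1 [_ [a2 Aa2 <-] <-]] le1] : exists2 c,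
      set_mulS A (set_invS A) c & natle c (a * b^*).
    by apply: AA; exists a => //; exists b^* => //; exists b.
  have [c [Ac ca1 ca2]] := dA' _ _ Aa1 Aa2.
  have [d [Ad dc da]] := dA' _ _ Ac Aa.
  exists d => //.
  have dd : natle (d * d^*) (a * b^*).
    apply: natle_trans le1; apply: natle_mul; first exact: natle_trans ca1.
    by apply: natle_inv; exact: natle_trans ca2.
  have {dd} := natle_inv dd; rewrite !sinvM !sinvK => dd.
  rewrite -(mulsVs d); apply: (@natle_trans _ (b * a^* * a)).
    exact: natle_mul.
  by rewrite -mulgA; exact: natle_mulr (idem_Vs a).
move=> AB; apply/dclsP; split.
  move=> _ [a1 Aa1 [_ [a2 Aa2 <-] <-]]; have [_ dA'] := dA.
  have [c [Ac ca1 ca2]] := dA' _ _ Aa1 Aa2.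
  have [[b Bb] _] := dB; have [a' Aa' a'b] := AB _ Bb.
  have [d [Ad dc da']] := dA' _ _ Ac Aa'.
  exists (d * b^*); first by exists d => //; exists b^* => //; exists b.
  rewrite (natle_trans da' a'b); apply: natle_mul; first exact: natle_trans ca1.
  by apply: natle_inv; exact: natle_trans ca2.
move=> _ [a Aa [_ [b Bb <-] <-]]; have [_ dA'] := dA.
have [a' Aa' a'b] := AB _ Bb; have [c [Ac ca ca']] := dA' _ _ Aa Aa'.
exists (c * c^*); first by exists c => //; exists c^* => //; exists c.
by apply: natle_mul => //; apply: natle_inv; exact: natle_trans a'b.
Qed.

(* The product is partial: gprod x y z means that xy is defined and equals z. *)
HB.mixin Record isGroupoid G := {
  gprod : G -> G -> G -> Prop;
  ginv : G -> G;
  gprod_fun : forall x y z z' : G, gprod x y z -> gprod x y z' -> z = z';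
  gprodA : forall x y z u v : G, gprod x y u -> gprod y z v ->
    exists2 w, gprod u z w & gprod x v w;
  ginvK : involutive ginv;
  gprodVx : forall x : G, exists u, gprod (ginv x) x u;
  gprodVK : forall x y z : G, gprod x y z -> gprod (ginv x) z y;
  gprodKV : forall x y z : G, gprod x y z -> gprod z (ginv y) x
}.

#[short(type="groupoidType")]
HB.structure Definition Groupoid := {G of isGroupoid G}.

(* gprod_continuous is the continuity of the product on the composable pairs,
   with the topology induced by the product topology. *)
HB.mixin Record isTopGroupoid G & Topological G & Groupoid G := {
  ginv_continuous : continuous (@ginv G);
  gprod_continuous : forall (x y z : G) (U : set G), gprod x y z -> nbhs z U ->
    \forall p \near (x, y), forall t, gprod p.1 p.2 t -> U t
}.

#[short(type="topGroupoidType")]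
HB.structure Definition TopGroupoid :=
  {G of isTopGroupoid G & Topological G & Groupoid G}.

Definition groupoid_hom (G H : groupoidType) (f : G -> H) :=
  forall x y z : G, gprod x y z -> gprod (f x) (f y) (f z).

Definition topgroupoid_iso (G H : topGroupoidType) (f : G -> H) :=
  [/\ groupoid_hom f, continuous f &
      exists f' : H -> G,
        [/\ cancel f f', cancel f' f, groupoid_hom f' & continuous f']].

Section Universal.
Variable S : invSemigroupType.

(* G_u(S) *)
Definition ugroupoid := dirclass S.

HB.instance Definition _ := InvSemigroup.on ugroupoid.

Implicit Types X Y Z : ugroupoid.

Definition ugprod X Y Z := X^* * X = Y * Y^* /\ Z = X * Y.

Lemma ugprod_fun X Y Z Z' : ugprod X Y Z -> ugprod X Y Z' -> Z = Z'.
Proof. by move=> [_ ->] [_ ->]. Qed.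

Lemma ugprodA X Y Z U V : ugprod X Y U -> ugprod Y Z V ->
  exists2 W, ugprod U Z W & ugprod X V W.
Proof.
move=> [xy ->] [yz ->]; exists (X * Y * Z); split; rewrite ?mulgA //.
  rewrite sinvM -yz.
  have -> : Y^* * X^* * X * Y = Y^* * (X^* * X) * Y by rewrite !mulgA.
  by rewrite xy !mulgA mulVsV.
rewrite sinvM xy.
have -> : Y * Z * (Z^* * Y^*) = Y * (Z * Z^*) * Y^* by rewrite !mulgA.
by rewrite -yz !mulgA mulsVs.
Qed.

Lemma ugprodVx X : exists U, ugprod X^* X U.
Proof. by exists (X^* * X); split; rewrite ?sinvK. Qed.

Lemma ugprodVK X Y Z : ugprod X Y Z -> ugprod X^* Z Y.
Proof.
move=> [xy ->]; split; last by rewrite mulgA xy mulsVs.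
rewrite sinvK sinvM; have -> : X * Y * (Y^* * X^*) = X * (Y * Y^*) * X^*.
  by rewrite !mulgA.
by rewrite -xy !mulgA mulsVs.
Qed.

Lemma ugprodKV X Y Z : ugprod X Y Z -> ugprod Z Y^* X.
Proof.
move=> [xy ->]; split; last by rewrite -mulgA -xy mulgA mulsVs.
rewrite sinvK sinvM; have -> : Y^* * X^* * (X * Y) = Y^* * (X^* * X) * Y.
  by rewrite !mulgA.
by rewrite xy !mulgA mulVsV.
Qed.

HB.instance Definition _ := isGroupoid.Build ugroupoid
  ugprod_fun ugprodA (@sinvK (dirclass S)) ugprodVx ugprodVK ugprodKV.

Definition point_cls (x : S) : ugroupoid := dcls (directed1 x).

(* U_x *)
Definition below (x : S) : set ugroupoid := [set X | natle X (point_cls x)].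

Definition below_diff (x : S) (xs : seq S) : set ugroupoid :=
  below x `&` [set X | forall y, y \in xs -> ~ below y X].

Definition ubase : set (set ugroupoid) :=
  [set W | exists x xs, (forall y, y \in xs -> natle y x) /\ W = below_diff x xs].

Lemma belowP x A dA : below x (@dcls S A dA) <-> exists2 a, A a & natle a x.
Proof.
rewrite /below /= natle_dcls; split; first exact.
by move=> Ax _ ->.
Qed.

Lemma point_clsM x y : point_cls (x * y) = point_cls x * point_cls y.
Proof.
rewrite /point_cls [RHS]mul_dcls; apply: dcls_eq; apply/seteqP; split=> z.
  by move=> ->; exists x => //; exists y.
by move=> [_ -> [_ -> <-]].
Qed.

Lemma point_clsV x : point_cls x^* = (point_cls x)^*.
Proof.
rewrite /point_cls [RHS]sinv_dcls; apply: dcls_eq; apply/seteqP; split=> z.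
  by move=> ->; exists x.
by move=> [_ -> <-].
Qed.

Lemma point_cls_le x y : natle x y -> natle (point_cls x) (point_cls y).
Proof. by move=> xy; apply/natle_dcls => _ ->; exists x. Qed.

Lemma le_meet (T : invSemigroupType) (t u v : T) :
  natle t u -> natle t v -> natle t (u * (v^* * v)).
Proof.
move=> tu tv; rewrite -(mulsVs t) -mulgA; apply: natle_mul => //.
by apply: natle_mul => //; exact: natle_inv.
Qed.

Lemma ubase_cover : \bigcup_(W in ubase) W = setT.
Proof.
apply/seteqP; split=> // X _; elim/dclsW: X => A dA.
have [[a Aa] _] := dA; exists (below_diff a [::]).
  by exists a, [::]; split.
by split=> //; apply/belowP; exists a.
Qed.

Lemma meet_le (w u v : S) : natle u w -> natle v w -> natle (u * (v^* * v)) v.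
Proof.
move=> /natle_eqr uw vw; rewrite {1}uw -mulgA (idemC (idem_Vs u) (idem_Vs v)).
by rewrite mulgA -(natle_eqr vw); exact: natle_mulr (idem_Vs u).
Qed.

Lemma below_diff_shrink x xs z X :
  (forall y, y \in xs -> natle y x) -> natle z x -> below z X ->
  below_diff x xs X <-> below_diff z [seq z * (y^* * y) | y <- xs] X.
Proof.
move=> xsx zx Xz; have Xx : below x X := natle_trans Xz (point_cls_le zx).
split=> -[_ h]; split=> // y.
  move=> /mapP[u uxs ->] Xu; apply: (h _ uxs).
  by apply: natle_trans Xu _; apply/point_cls_le/(meet_le zx)/xsx.
move=> yxs Xy; apply: (h (z * (y^* * y))); first by apply/mapP; exists y.
rewrite /below /= !point_clsM point_clsV; exact: le_meet.
Qed.

Lemma ubase_shrink x xs X :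
  (forall y, y \in xs -> natle y x) -> below_diff x xs X ->
  forall z, natle z x -> below z X ->
  exists zs, [/\ forall y, y \in zs -> natle y z, below_diff z zs X &
    below_diff z zs `<=` below_diff x xs].
Proof.
move=> xsx Xx z zx Xz; exists [seq z * (y^* * y) | y <- xs]; split.
- by move=> _ /mapP[y _ ->]; exact: natle_mulr (idem_Vs y).
- exact/(below_diff_shrink xsx zx Xz).
- by move=> Y Yz; apply/(below_diff_shrink xsx zx) => //; case: Yz.
Qed.

Lemma ubase_join (U V : set ugroupoid) X : ubase U -> ubase V -> U X -> V X ->
  exists W, [/\ ubase W, W X & W `<=` U `&` V].
Proof.
move=> [x [xs [xsx ->]]] [y [ys [ysy ->]]] XU XV.
have [z [zx zy Xz]] : exists z, [/\ natle z x, natle z y & below z X].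
  have := XV.1; have := XU.1; elim/dclsW: (X) => A dA.
  move=> /belowP[a Aa ax] /belowP[b Ab bY].
  have [_ /(_ _ _ Aa Ab)[c [Ac ca cb]]] := dA.
  by exists c; split; [exact: natle_trans ax|exact: natle_trans bY|
    apply/belowP; exists c].
have [z1 [z1z Xz1 s1]] := ubase_shrink xsx XU zx Xz.
have [z2 [z2z Xz2 s2]] := ubase_shrink ysy XV zy Xz.
exists (below_diff z (z1 ++ z2)); split.
- exists z, (z1 ++ z2); split=> // u; rewrite mem_cat => /orP[/z1z|/z2z] //.
- split=> // u; rewrite mem_cat => /orP[]; [exact: Xz1.2|exact: Xz2.2].
- move=> Y [Yz h]; split; [apply: s1|apply: s2]; split=> // u uz;
  by apply: h; rewrite mem_cat uz ?orbT.
Qed.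

HB.instance Definition _ := isBaseTopological.Build ugroupoid
  ubase_cover ubase_join.

Lemma ubase_open W : ubase W -> open W.
Proof. by move=> bW; exists [set W]; [move=> _ ->|rewrite bigcup_set1]. Qed.

Lemma nbhs_ugroupoidP X U :
  nbhs X U <-> exists W, [/\ ubase W, W X & W `<=` U].
Proof.
split.
  rewrite nbhsE => -[B [[D' sD <-] [W D'W WX]] BU]; exists W; split=> //.
    exact: sD.
  by move=> Y WY; apply: BU; exists W.
move=> [W [bW WX WU]]; rewrite nbhsE; exists W => //; split=> //.
exact: ubase_open.
Qed.

Lemma ug_inv_continuous : continuous (@ginv ugroupoid).
Proof.
move=> X U /nbhs_ugroupoidP[_ [[x [xs [xsx ->]]] [Xx h] WU]].
have bV y Y : below y^* Y <-> below y (Y^* : ugroupoid).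
  by rewrite /below /= point_clsV; split=> /natle_inv; rewrite sinvK.
apply/nbhs_ugroupoidP; exists (below_diff x^* [seq y^* | y <- xs]); split.
- exists x^*, [seq y^* | y <- xs]; split=> // _ /mapP[y /xsx yx ->].
  exact: natle_inv.
- split; first exact/bV.
  by move=> _ /mapP[y yxs ->] /bV; apply: h.
- move=> Y [Yx hY]; apply: WU; split; first exact/bV.
  by move=> y yxs /bV; apply: hY; apply/mapP; exists y.
Qed.

Lemma ug_prod_continuous X Y Z (U : set ugroupoid) : gprod X Y Z -> nbhs Z U ->
  \forall p \near (X, Y), forall t, gprod p.1 p.2 t -> U t.
Proof.
move=> [XY ->] /nbhs_ugroupoidP[_ [[w [ws [wsw ->]]] XYw WU]].
have [a [b [Xa Yb abw]]] :
    exists a b, [/\ below a X, below b Y & natle (a * b) w].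
  move: XYw => [+ _] {XY}; elim/dclsW: X => A dA; elim/dclsW: Y => B dB.
  rewrite [dcls dA * dcls dB]mul_dcls => /belowP[_ [a Aa [b Bb <-]] abw].
  by exists a, b; split=> //; apply/belowP; [exists a|exists b].
have XYab : below (a * b) (X * Y).
  by rewrite /below /= point_clsM; exact: natle_mul.
have [vs [vab XYv sv]] := ubase_shrink wsw XYw abw XYab.
exists (below_diff a [seq v * b^* | v <- vs], below b); last first.
  move=> [X' Y'] /= [[X'a hX'] Y'b] t [X'Y' ->]; apply/WU/sv; split.
    by rewrite /below /= point_clsM; exact: natle_mul.
  move=> v vvs X'Y'v; apply: (hX' (v * b^*)); first by apply/mapP; exists v.
  have -> : X' = X' * Y' * Y'^* by rewrite -mulgA -X'Y' mulgA mulsVs.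
  by rewrite /below /= point_clsM point_clsV; apply: natle_mul => //; exact: natle_inv.
split; apply/nbhs_ugroupoidP => /=.
  exists (below_diff a [seq v * b^* | v <- vs]); split=> //.
    exists a, [seq v * b^* | v <- vs]; split=> // _ /mapP[v /vab vleab ->].
    apply: (@natle_trans _ (a * b * b^*)); first exact: natle_mul.
    by rewrite -mulgA; exact: natle_mulr (idem_sV b).
  split=> // _ /mapP[v vvs ->] Xv; apply: (XYv.2 _ vvs).
  apply: (@natle_trans _ (point_cls (v * b^*) * point_cls b)).
    exact: natle_mul.
  by rewrite -point_clsM; apply: point_cls_le; rewrite -mulgA;
    exact: natle_mulr (idem_Vs b).
exists (below b); split=> //; exists b, [::]; split=> //.
by apply/seteqP; split=> // V [].
Qed.

HB.instance Definition _ :=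
  isTopGroupoid.Build ugroupoid ug_inv_continuous ug_prod_continuous.

End Universal.

Section MinimalSubgroupoid.
Variable S : invSemigroupType.

Definition minimal_set : set (ugroupoid S) := [set X | is_minimal X].

(* G_m(S); minimality is with respect to the natural order of O(S), and the
   topology on a set_type is the subspace topology *)
Definition mgroupoid := set_type minimal_set.

HB.instance Definition _ := Topological.on mgroupoid.

Implicit Types X Y Z : mgroupoid.

Definition mkmin (X : ugroupoid S) (mX : is_minimal X) : mgroupoid :=
  exist _ X (mem_set (mX : minimal_set X)).

Lemma mgroupoidP X : is_minimal (set_val X).
Proof. exact: set_mem (valP X). Qed.

Definition mgprod X Y Z := gprod (set_val X) (set_val Y) (set_val Z).

Definition mginv X : mgroupoid := mkmin (minimal_inv (mgroupoidP X)).

Lemma mgprod_ex X Y (Z : ugroupoid S) :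
  gprod (set_val X) (set_val Y) Z -> exists2 Z', mgprod X Y Z' & set_val Z' = Z.
Proof.
move=> [XY ZE].
by exists (mkmin (minimal_mul XY (mgroupoidP X) (mgroupoidP Y))); rewrite ?ZE.
Qed.

Lemma mgprod_fun X Y Z Z' : mgprod X Y Z -> mgprod X Y Z' -> Z = Z'.
Proof. by move=> h1 h2; apply: val_inj; exact: (@gprod_fun (ugroupoid S) _ _ _ _ h1 h2). Qed.

Lemma mgprodA X Y Z U V : mgprod X Y U -> mgprod Y Z V ->
  exists2 W, mgprod U Z W & mgprod X V W.
Proof.
move=> XYU YZV; have [W UZ XV] := @gprodA (ugroupoid S) _ _ _ _ _ XYU YZV.
have [W' UZW' eW] := mgprod_ex UZ; exists W' => //.
by rewrite /mgprod eW.
Qed.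

Lemma mginvK : involutive mginv.
Proof. by move=> X; apply: val_inj; exact: (ginvK (set_val X)). Qed.

Lemma mgprodVx X : exists U, mgprod (mginv X) X U.
Proof.
have [U XU] := gprodVx (set_val X).
by have [U' ? _] := mgprod_ex (XU : gprod (set_val (mginv X)) _ _); exists U'.
Qed.

Lemma mgprodVK X Y Z : mgprod X Y Z -> mgprod (mginv X) Z Y.
Proof. exact: (@gprodVK (ugroupoid S)). Qed.

Lemma mgprodKV X Y Z : mgprod X Y Z -> mgprod Z (mginv Y) X.
Proof. exact: (@gprodKV (ugroupoid S)). Qed.

HB.instance Definition _ := isGroupoid.Build mgroupoid
  mgprod_fun mgprodA mginvK mgprodVx mgprodVK mgprodKV.

Lemma nbhs_mgroupoidP X (U : set mgroupoid) :
  nbhs X U <-> exists2 V, nbhs (set_val X) V & set_val @^-1` V `<=` U.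
Proof.
split.
  case=> B [[V oV <-] VX BU]; exists V => //.
  by apply: open_nbhs_nbhs; split.
move=> [V nV VU]; apply: filterS VU _.
exact: (@initial_continuous mgroupoid (ugroupoid S) set_val X V nV).
Qed.

Lemma mg_inv_continuous : continuous (@ginv mgroupoid).
Proof.
move=> X U /nbhs_mgroupoidP[V nV VU]; apply/nbhs_mgroupoidP.
exists (@ginv (ugroupoid S) @^-1` V); first exact: (@ginv_continuous (ugroupoid S) (set_val X) V nV).
by move=> Y VY; apply: VU.
Qed.

Lemma mg_prod_continuous X Y Z (U : set mgroupoid) : gprod X Y Z -> nbhs Z U ->
  \forall p \near (X, Y), forall t, gprod p.1 p.2 t -> U t.
Proof.
move=> XYZ /nbhs_mgroupoidP[V nV VU].
have [[A B] /= [nA nB] AB] := @gprod_continuous (ugroupoid S) _ _ _ _ XYZ nV.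
exists (set_val @^-1` A, set_val @^-1` B).
  by split; apply/nbhs_mgroupoidP; [exists A|exists B].
move=> [X' Y'] /= [AX BY] t XYt; apply: VU.
exact: (AB (set_val X', set_val Y')).
Qed.

HB.instance Definition _ :=
  isTopGroupoid.Build mgroupoid mg_inv_continuous mg_prod_continuous.

End MinimalSubgroupoid.

Record digraph := Digraph {
  vertex : Type;
  edge : Type;
  rng : edge -> vertex;
  src : edge -> vertex
}.

Section Graph.
Variable g : digraph.

Fixpoint is_path (v : vertex g) (l : seq (edge g)) : Prop :=
  if l is e :: l' then src e = v /\ is_path (rng e) l' else True.

(* The source vertex is recorded separately so that the same type contains the
   vertices, as the paths without edges; when there is an edge, it is the
   source of the first one. *)
Record fpath := FPath {
  fsrc : vertex g;
  fedges : seq (edge g);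
  fpathP : is_path fsrc fedges
}.

Definition frng (p : fpath) : vertex g := last (fsrc p) (map (@rng g) (fedges p)).

Definition flen (p : fpath) : nat := size (fedges p).

(* concat p m q : the concatenation pm is defined, and it is q *)
Definition concat (p m q : fpath) : Prop :=
  [/\ frng p = fsrc m, fsrc q = fsrc p & fedges q = fedges p ++ fedges m].

(* iedge x i is the (i+1)-st edge of the infinite path x *)
Record ipath := IPath {
  iedge : nat -> edge g;
  ipathP : forall i, src (iedge i.+1) = rng (iedge i)
}.

(* the i-th edge x_i, counted from 1 *)
Definition ith (x : ipath) (i : nat) : edge g := iedge x i.-1.

Definition isrc (x : ipath) : vertex g := src (ith x 1).

(* iconcat p m x : the concatenation pm is defined, and it is x *)
Definition iconcat (p : fpath) (m x : ipath) : Prop :=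
  frng p = isrc m /\
  forall i, iedge x i =
    if (i < flen p)%N then nth (iedge m 0) (fedges p) i else iedge m (i - flen p).

Definition iprefix (p : fpath) (x : ipath) : Prop := exists m, iconcat p m x.

Lemma is_path_cat v l l' :
  is_path v (l ++ l') <-> is_path v l /\ is_path (last v (map (@rng g) l)) l'.
Proof.
elim: l v => [|e l IHl] v /=; first by split=> [|[]].
by rewrite IHl; split=> [[? [? ?]]|[[? ?] ?]].
Qed.

Lemma fpath_eq p q : fsrc p = fsrc q -> fedges p = fedges q -> p = q.
Proof.
case: p q => [v l pl] [v' l' pl'] /= vv ll.
case: _ / vv in pl' *; case: _ / ll in pl' *.
by congr FPath; exact: Prop_irrelevance.
Qed.

Lemma cat_injr (T : Type) (l m n : seq T) : l ++ m = l ++ n -> m = n.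
Proof. by elim: l => //= e l IHl [/IHl]. Qed.

Lemma concat_ex p m : frng p = fsrc m -> exists q, concat p m q.
Proof.
move=> pm; have h : is_path (fsrc p) (fedges p ++ fedges m).
  by apply/is_path_cat; split; [exact: fpathP|rewrite -/(frng p) pm; exact: fpathP].
by exists (FPath h).
Qed.

Lemma concat_rng p m q : concat p m q -> frng q = frng m.
Proof. by move=> [pm sq eq]; rewrite /frng eq sq map_cat last_cat -/(frng p) pm. Qed.

Lemma concatA p m n pm q : concat p m pm -> concat pm n q ->
  exists2 mn, concat m n mn & concat p mn q.
Proof.
move=> cpm cq; have [h1 h2 h3] := cpm; have [h4 h5 h6] := cq.
have mn : frng m = fsrc n by rewrite -(concat_rng cpm).
have [k [k1 k2 k3]] := concat_ex mn; exists k => //; split; rewrite ?k2 //.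
  by rewrite h5.
by rewrite h6 h3 k3 catA.
Qed.

Lemma concat_vertex p : exists m, concat p m p.
Proof. by exists (@FPath (frng p) [::] I); split; rewrite ?cats0. Qed.

(* the path (x_1, ..., x_n), or the source of x when n = 0 *)
Lemma itake_subproof x n : is_path (isrc x) (mkseq (iedge x) n).
Proof.
have h i : is_path (src (iedge x i)) (map (iedge x) (iota i n)).
  by elim: n i => //= n IHn i; split=> //; rewrite -ipathP; exact: IHn.
exact: h 0.
Qed.

Definition itake x n : fpath := FPath (itake_subproof x n).

Lemma flen_itake x n : flen (itake x n) = n. Proof. exact: size_mkseq. Qed.

Lemma frng_itake x n : (0 < n)%N -> frng (itake x n) = rng (ith x n).
Proof.
case: n => // n _.
by rewrite /frng -[fedges _]/(mkseq _ _) mkseqS map_rcons last_rcons.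
Qed.

Lemma frng_itakeS x n : frng (itake x n) = src (iedge x n).
Proof. by case: n => [//|n]; rewrite frng_itake // ipathP. Qed.

Lemma iprefixP p x : iprefix p x <-> p = itake x (flen p).
Proof.
split.
  move=> [m [pm mx]]; apply: fpath_eq => /=.
    rewrite /isrc /ith /= mx; case: p pm {mx} => v [|e l] //= pl pm; last by have [<-] := pl.
  apply: (@eq_from_nth _ (iedge m 0)); rewrite ?size_mkseq // => i ip.
  by rewrite nth_mkseq // mx ip.
move=> pE; set n := flen p in pE *.
exists (@IPath (fun i => iedge x (i + n)) (fun i => ipathP x (i + n))).
split; first by rewrite pE frng_itakeS /isrc /ith /= add0n.
move=> i; rewrite -/n; case: ltnP => [iltn|nlei] /=; last by rewrite subnK.
by rewrite pE /= nth_mkseq.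
Qed.

Lemma iprefix_itake x n : iprefix (itake x n) x.
Proof. by apply/iprefixP; rewrite flen_itake. Qed.

Lemma iprefix_len p q x y : iprefix p x -> iprefix q x -> (flen p <= flen q)%N ->
  iprefix q y -> iprefix p y.
Proof.
move=> /iprefixP px /iprefixP qx pq /iprefixP qy; apply/iprefixP.
have e i : (i < flen q)%N -> iedge x i = iedge y i.
  move=> iq; have := congr1 (fun p => nth (iedge x 0) (fedges p) i) qx.
  by rewrite {1}qy /= !nth_mkseq.
rewrite {1}px; apply: fpath_eq => /=.
  by have := congr1 fsrc qx; rewrite {1}qy.
by apply/eq_in_map => i; rewrite mem_iota => /andP[_ ip]; apply/e/(leq_trans ip).
Qed.

Lemma iprefix_ith p x y i : iprefix p x -> iprefix p y -> (0 < i <= flen p)%N ->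
  ith x i = ith y i.
Proof.
move=> /iprefixP px /iprefixP py /andP[i0 ip].
have := congr1 (fun p => nth (iedge x 0) (fedges p) i.-1) px.
by rewrite {1}py /= !nth_mkseq ?prednK.
Qed.

Record gpair := GPair {
  gp1 : fpath;
  gp2 : fpath;
  gpairP : frng gp1 = frng gp2
}.

Lemma gpair_eq a b : gp1 a = gp1 b -> gp2 a = gp2 b -> a = b.
Proof.
case: a b => [p q pq] [p' q' pq'] /= pp qq.
case: _ / pp in pq' *; case: _ / qq in pq' *.
by congr GPair; exact: Prop_irrelevance.
Qed.

HB.instance Definition _ := gen_eqMixin gpair.
HB.instance Definition _ := gen_choiceMixin gpair.

(* Gamma(g); None is the zero *)
Definition graph_semigroup := option gpair.

HB.instance Definition _ := Choice.on graph_semigroup.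

(* the nonzero products:
   (alpha, beta)(beta mu, delta) = (alpha mu, delta) and
   (alpha, gamma mu)(gamma, delta) = (alpha, delta mu) *)
Definition gpair_prod (a b c : gpair) : Prop :=
  (exists mu, [/\ concat (gp2 a) mu (gp1 b), concat (gp1 a) mu (gp1 c) &
                  gp2 c = gp2 b]) \/
  (exists mu, [/\ concat (gp1 b) mu (gp2 a), gp1 c = gp1 a &
                  concat (gp2 b) mu (gp2 c)]).

Definition gs_mul (u v : graph_semigroup) : graph_semigroup :=
  if u is Some a then
    if v is Some b then xget None [set w | exists2 c, w = Some c & gpair_prod a b c]
    else None
  else None.

Definition gpair_swap (a : gpair) : gpair := GPair (esym (gpairP a)).

Definition gs_inv (u : graph_semigroup) : graph_semigroup := omap gpair_swap u.

(* the partial bijection q mu |-> p mu of the set of finite paths given by (p, q) *)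
Definition gs_act (u : graph_semigroup) (p q : fpath) : Prop :=
  if u is Some a then exists m, concat (gp1 a) m p /\ concat (gp2 a) m q else False.

Lemma gs_act_inv u p q : gs_act (gs_inv u) p q <-> gs_act u q p.
Proof. by case: u => //= a; split=> -[m [? ?]]; exists m. Qed.

Lemma gpair_prod_swap a b c :
  gpair_prod a b c -> gpair_prod (gpair_swap b) (gpair_swap a) (gpair_swap c).
Proof. by case=> -[m [h1 h2 h3]]; [right|left]; exists m. Qed.

Lemma gpair_prod_act1 a b c p q : 
  (exists mu, [/\ concat (gp2 a) mu (gp1 b), concat (gp1 a) mu (gp1 c) &
                  gp2 c = gp2 b]) ->
  gs_act (Some c) p q <-> exists m, gs_act (Some a) p m /\ gs_act (Some b) m q.
Proof.
move=> [nu [ab ac cb]]; split=> /=.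
  move=> [mu [cp]]; rewrite cb => bq.
  have [k nk ak] := concatA ac cp.
  have [m bm] : exists m, concat (gp1 b) mu m.
    by apply: concat_ex; rewrite gpairP; case: bq.
  exists m; split; last by exists mu.
  exists k; split=> //; have [k' nk' ak'] := concatA ab bm.
  suff <- : k' = k by [].
  by case: nk nk' => _ s e [_ s' e']; apply: fpath_eq; rewrite ?s ?s' ?e ?e'.
move=> [m [[k [ap am]] [mu [bm bq]]]]; exists mu; rewrite cb; split=> //.
have [k' nk' ak'] := concatA ab bm.
have kk : k' = k.
  case: ak' am => s _ e [s' _ e']; apply: fpath_eq; first by rewrite -s -s'.
  by move: e; rewrite e' => /cat_injr.
rewrite kk in nk' ak'; case: ac ap nk' => h1 h2 h3 [h4 h5 h6] [h7 h8 h9].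
split; last by rewrite h6 h9 catA h3.
  by rewrite gpairP cb -gpairP; case: bm.
by rewrite h5 h2.
Qed.

Lemma gpair_prod_act a b c p q : gpair_prod a b c ->
  gs_act (Some c) p q <-> exists m, gs_act (Some a) p m /\ gs_act (Some b) m q.
Proof.
case; first exact: gpair_prod_act1.
move=> h; have h' : gpair_prod a b c by right.
rewrite -gs_act_inv (@gpair_prod_act1 (gpair_swap b) (gpair_swap a)); last first.
  by case: h => m [h1 h2 h3]; exists m; split.
split=> -[m [h1 h2]]; exists m; split.
- by apply/gs_act_inv.
- by apply/gs_act_inv.
- by apply/(gs_act_inv (Some b)).
- by apply/(gs_act_inv (Some a)).
Qed.

Lemma concat_factor p k q l m : concat p k m -> concat q l m ->
  (flen p <= flen q)%N -> exists n, concat p n q.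
Proof.
move=> [h1 h2 h3] [h4 h5 h6] pq.
have e : fedges q = fedges p ++ drop (flen p) (fedges q).
  have e1 : take (flen q) (fedges m) = fedges q by rewrite h6 take_size_cat.
  rewrite -{1}(cat_take_drop (flen p) (fedges q)); congr (_ ++ _).
  by rewrite -e1 take_takel // h3 take_size_cat.
have v : is_path (frng p) (drop (flen p) (fedges q)).
  have := fpathP q; rewrite {1}e => /is_path_cat[_].
  by rewrite -h5 h2.
by exists (FPath v); split=> //=; rewrite -h5 h2.
Qed.

Lemma gpair_prod_ex a b p m q : gs_act (Some a) p m -> gs_act (Some b) m q ->
  exists c, gpair_prod a b c.
Proof.
move=> [k [ap am]] [l [bm bq]].
have [ab|ba] := leqP (flen (gp2 a)) (flen (gp1 b)).
  have [n abn] := concat_factor am bm ab.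
  have [r ar] : exists r, concat (gp1 a) n r.
    by apply: concat_ex; rewrite gpairP; case: abn.
  have rr : frng r = frng (gp2 b).
    by rewrite (concat_rng ar) -(concat_rng abn) gpairP.
  by exists (GPair rr); left; exists n.
have [n ban] := concat_factor bm am (ltnW ba).
have [r br] : exists r, concat (gp2 b) n r.
  by apply: concat_ex; rewrite -gpairP; case: ban.
have rr : frng (gp1 a) = frng r.
  by rewrite (concat_rng br) -(concat_rng ban) gpairP.
by exists (GPair rr); right; exists n.
Qed.

Lemma gs_act_mul u v p q :
  gs_act (gs_mul u v) p q <-> exists m, gs_act u p m /\ gs_act v m q.
Proof.
case: u v => [a|] [b|]; rewrite /gs_mul; try by split=> [|[m []]].
case: xgetP => [_ _ [c -> abc]|nc]; first exact: gpair_prod_act.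
split=> // -[m [am bm]]; have [c abc] := gpair_prod_ex am bm.
by case: (nc (Some c)); exists c.
Qed.

Lemma gs_act_id a : gs_act (Some a) (gp1 a) (gp2 a).
Proof.
exists (@FPath (frng (gp1 a)) [::] I); split; split=> //=; rewrite ?cats0 //.
by rewrite gpairP.
Qed.

Lemma concat_anti p q m n : concat p m q -> concat q n p -> p = q.
Proof.
move=> [_ s e] [_ s' e']; apply: fpath_eq; first by rewrite s.
have : (flen m + flen n)%N = 0.
  have /(congr1 size) := e'; rewrite e !size_cat => /eqP.
  by rewrite -{1}(addn0 (size (fedges p))) -addnA eqn_add2l eq_sym => /eqP.
by move=> /eqP; rewrite addn_eq0 => /andP[/eqP/size0nil m0 _]; rewrite e m0 cats0.
Qed.

Lemma gs_act_inj u v : (forall p q, gs_act u p q <-> gs_act v p q) -> u = v.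
Proof.
case: u v => [a|] [b|] h //.
- have [m [h1 h2]] := (h _ _).1 (gs_act_id a).
  have [n [h3 h4]] := (h _ _).2 (gs_act_id b).
  by congr Some; apply: gpair_eq; [exact: concat_anti h3 h1|exact: concat_anti h4 h2].
- by case: ((h _ _).1 (gs_act_id a)).
- by case: ((h _ _).2 (gs_act_id b)).
Qed.

Lemma concat_inj p m m' q : concat p m q -> concat p m' q -> m = m'.
Proof.
move=> [h1 h2 h3] [h4 h5 h6]; apply: fpath_eq; first by rewrite -h1 -h4.
by move: h3; rewrite h6 => /cat_injr.
Qed.

Lemma concat_fun p m q q' : concat p m q -> concat p m q' -> q = q'.
Proof.
by move=> [_ s e] [_ s' e']; apply: fpath_eq; rewrite ?s ?s' ?e ?e'.
Qed.

Lemma gs_act_fun u p q q' : gs_act u p q -> gs_act u p q' -> q = q'.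
Proof.
case: u => // a [m [h1 h2]] [m' [h3 h4]].
by rewrite -(concat_inj h1 h3) in h4; exact: concat_fun h4.
Qed.

Lemma gs_act_pinj u p p' q : gs_act u p q -> gs_act u p' q -> p = p'.
Proof.
by move=> /gs_act_inv h /gs_act_inv; apply: gs_act_fun h.
Qed.

Lemma gs_mulA : associative gs_mul.
Proof.
move=> u v w; apply: gs_act_inj => p q; rewrite !gs_act_mul; split.
  move=> [m [um /gs_act_mul[n [vn wn]]]]; exists n; split=> //.
  by apply/gs_act_mul; exists m.
move=> [n [/gs_act_mul[m [um vm]] wn]]; exists m; split=> //.
by apply/gs_act_mul; exists n.
Qed.

HB.instance Definition _ := isSemigroup.Build graph_semigroup gs_mulA.

Lemma gs_mulVs (u : graph_semigroup) : u * gs_inv u * u = u.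
Proof.
apply: gs_act_inj => p q; rewrite gs_act_mul; split.
  move=> [m [/gs_act_mul[n [un /gs_act_inv um]] umq]].
  by rewrite (gs_act_pinj un um).
move=> upq; exists p; split=> //; apply/gs_act_mul; exists q; split=> //.
exact/gs_act_inv.
Qed.

Lemma gs_invK : involutive gs_inv.
Proof. by case=> //= a; congr Some; apply: gpair_eq. Qed.

Lemma gs_invM (u v : graph_semigroup) : gs_inv (u * v) = gs_inv v * gs_inv u.
Proof.
apply: gs_act_inj => p q; rewrite gs_act_inv !gs_act_mul.
by split=> -[m [h1 h2]]; exists m; split; apply/gs_act_inv; rewrite ?gs_invK.
Qed.

Lemma gs_act_proj u p q :
  gs_act (gs_mul u (gs_inv u)) p q <-> p = q /\ exists m, gs_act u p m.
Proof.
rewrite gs_act_mul; split.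
  by move=> [m [um /gs_act_inv uq]]; split; [exact: gs_act_pinj um uq|exists m].
by move=> [<- [m um]]; exists m; split=> //; exact/gs_act_inv.
Qed.

Lemma gs_projC (u v : graph_semigroup) :
  (u * gs_inv u) * (v * gs_inv v) = (v * gs_inv v) * (u * gs_inv u).
Proof.
apply: gs_act_inj => p q; rewrite !gs_act_mul.
by split=> -[m [/gs_act_proj[<- e1] /gs_act_proj[<- e2]]]; exists p;
  split; apply/gs_act_proj.
Qed.

Lemma gs_inv_uniq (u v : graph_semigroup) :
  u * v * u = u -> v * u * v = v -> v = gs_inv u.
Proof. exact: eqn_inv_uniq gs_mulVs gs_invK gs_invM gs_projC _ _. Qed.

Lemma gs_mulVsV (u : graph_semigroup) : gs_inv u * u * gs_inv u = gs_inv u.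
Proof. by have := gs_mulVs (gs_inv u); rewrite gs_invK. Qed.

HB.instance Definition _ := Semigroup_isInvSemigroup.Build graph_semigroup
  gs_mulVs gs_mulVsV gs_inv_uniq.

End Graph.

Section PathGroupoid.
Variable g : digraph.
Implicit Types (x y z : ipath g) (k l : int) (N : nat).

(* x_i = y_(i + k) for all i >= N *)
Definition agree_from N k x y : Prop :=
  forall i j : nat, (N <= i)%N -> (j%:Z = i%:Z + k)%R -> ith x i = ith y j.

(* N is an admissible bound N(x,y) for x ~_k y *)
Definition tail_bound N k x y : Prop :=
  [/\ (1 <= N)%N, (1 <= N%:Z + k)%R & agree_from N k x y].

Definition tail_equiv k x y : Prop := exists N, tail_bound N k x y.

(* G(g), the triples (x, k, y) with x ~_k y *)
Record path_groupoid := PathGroupoid {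
  pleft : ipath g;
  plag : int;
  pright : ipath g;
  ptail : tail_equiv plag pleft pright
}.

Implicit Types s t u v w : path_groupoid.

Lemma path_groupoid_eq s t : pleft s = pleft t -> plag s = plag t ->
  pright s = pright t -> s = t.
Proof.
case: s t => [x k y h] [x' k' y' h'] /= xx kk yy.
case: _ / xx in h' *; case: _ / kk in h' *; case: _ / yy in h' *.
by congr PathGroupoid; exact: Prop_irrelevance.
Qed.

HB.instance Definition _ := gen_eqMixin path_groupoid.
HB.instance Definition _ := gen_choiceMixin path_groupoid.

Lemma tail_equiv0 x : tail_equiv 0 x x.
Proof. by exists 1%N; split=> // i j _; rewrite GRing.addr0 => -[->]. Qed.

Lemma tail_equivD k l x y z :
  tail_equiv k x y -> tail_equiv l y z -> tail_equiv (k + l)%R x z.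
Proof.
move=> [N [N1 Nk xy]] [M [M1 Ml yz]]; exists (N + M + `|k|)%N.
split; [lia|lia|move=> i j Ni jE].
have [h hE] : exists h : nat, (h%:Z = i%:Z + k)%R by exists `|(i%:Z + k)%R|%N; lia.
by rewrite (xy _ h) //; [apply: yz; lia|lia].
Qed.

Lemma tail_equivN k x y : tail_equiv k x y -> tail_equiv (- k)%R y x.
Proof.
move=> [N [N1 Nk xy]]; exists `|(N%:Z + k)%R|%N.
split; [lia|lia|move=> i j Ni jE].
by apply/esym/xy; lia.
Qed.

Definition pgprod s t u : Prop :=
  [/\ pright s = pleft t, pleft u = pleft s, plag u = (plag s + plag t)%R &
      pright u = pright t].

Definition pginv s : path_groupoid := PathGroupoid (tail_equivN (ptail s)).

Lemma pgprod_ex s t : pright s = pleft t -> exists u, pgprod s t u.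
Proof.
move=> st; have ht := ptail t; rewrite -st in ht.
by exists (PathGroupoid (tail_equivD (ptail s) ht)).
Qed.

Lemma pgprod_fun s t u u' : pgprod s t u -> pgprod s t u' -> u = u'.
Proof.
by move=> [_ a b c] [_ a' b' c']; apply: path_groupoid_eq;
  rewrite ?a ?b ?c ?a' ?b' ?c'.
Qed.

Lemma pgprodA s t u v w : pgprod s t v -> pgprod t u w ->
  exists2 p, pgprod v u p & pgprod s w p.
Proof.
move=> [st vs kv vt] [tu wt kw wu].
have [p vup] : exists p, pgprod v u p by apply: pgprod_ex; rewrite vt.
exists p => //; case: vup => _ pv kp pu; split; rewrite ?wt ?pv ?pu ?wu //.
by rewrite kp kv kw; lia.
Qed.

Lemma pginvK : involutive pginv.
Proof. by move=> s; apply: path_groupoid_eq => //=; lia. Qed.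

Lemma pgprodVx s : exists u, pgprod (pginv s) s u.
Proof. exact: pgprod_ex. Qed.

Lemma pgprodVK s t u : pgprod s t u -> pgprod (pginv s) u t.
Proof. by move=> [st us ku ut]; split=> //=; rewrite ku; lia. Qed.

Lemma pgprodKV s t u : pgprod s t u -> pgprod u (pginv t) s.
Proof. by move=> [st us ku ut]; split=> //=; rewrite ku; lia. Qed.

HB.instance Definition _ := isGroupoid.Build path_groupoid
  pgprod_fun pgprodA pginvK pgprodVx pgprodVK pgprodKV.

(* Z(alpha, beta) *)
Definition cylinder (a : gpair g) : set path_groupoid :=
  [set t | [/\ iprefix (gp1 a) (pleft t), iprefix (gp2 a) (pright t),
               plag t = ((flen (gp2 a))%:Z - (flen (gp1 a))%:Z)%R &
               agree_from (flen (gp1 a)).+1 (plag t) (pleft t) (pright t)]].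

Definition cylinders : set (set path_groupoid) := range cylinder.

Lemma cylinder_take t N n m : tail_bound N (plag t) (pleft t) (pright t) ->
  (N <= n)%N -> (m%:Z = n%:Z + plag t)%R ->
  exists a, [/\ gp1 a = itake (pleft t) n, gp2 a = itake (pright t) m &
    cylinder a t].
Proof.
move=> [N1 Nk h] Nn mE.
have r : frng (itake (pleft t) n) = frng (itake (pright t) m).
  by rewrite !frng_itake ?(h n m) //; lia.
exists (GPair r); split=> //; split=> /=; rewrite ?flen_itake.
- exact: iprefix_itake.
- exact: iprefix_itake.
- by lia.
- by move=> i j ni jE; apply: h => //; lia.
Qed.

Lemma cylinder_sub a b t : cylinder a t -> cylinder b t ->
  (flen (gp1 a) <= flen (gp1 b))%N -> cylinder b `<=` cylinder a.
Proof.
move=> [a1 a2 ka ha] [b1 b2 kb hb] ab t' [b1' b2' kb' hb'].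
have ab2 : (flen (gp2 a) <= flen (gp2 b))%N by lia.
split; [exact: iprefix_len a1 b1 ab b1'|exact: iprefix_len a2 b2 ab2 b2'|by lia|].
move=> i j ai jE; have [ib|bi] := leqP i (flen (gp1 b)); last exact: hb'.
rewrite -(iprefix_ith b1 b1'); last by lia.
by rewrite -(iprefix_ith b2 b2'); [apply: ha; lia|lia].
Qed.

Lemma cylinder_len t (M : nat) :
  exists a, cylinder a t /\ (M <= flen (gp1 a))%N.
Proof.
have [N hN] := ptail t; have [N1 Nk h] := hN.
have [a [a1 a2 at_]] := @cylinder_take t N (N + M) `|((N + M)%N%:Z + plag t)%R|%N
  hN (leq_addr _ _) ltac:(lia).
by exists a; split=> //; rewrite a1 flen_itake; lia.
Qed.

Lemma cylinders_cover : \bigcup_(W in cylinders) W = setT.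
Proof.
apply/seteqP; split=> // t _; have [a [at_ _]] := cylinder_len t 0.
by exists (cylinder a) => //; exists a.
Qed.

Lemma cylinders_join (U V : set path_groupoid) t :
  cylinders U -> cylinders V -> U t -> V t ->
  exists W, [/\ cylinders W, W t & W `<=` U `&` V].
Proof.
move=> [a _ <-] [b _ <-] at_ bt.
have [ab|ba] := leqP (flen (gp1 a)) (flen (gp1 b)).
  exists (cylinder b); split=> //; first by exists b.
  by rewrite subsetI; split=> //; exact: cylinder_sub at_ bt ab.
exists (cylinder a); split=> //; first by exists a.
by rewrite subsetI; split=> //; exact: cylinder_sub bt at_ (ltnW ba).
Qed.

HB.instance Definition _ := isBaseTopological.Build path_groupoid
  cylinders_cover cylinders_join.

Lemma nbhs_path_groupoidP t (U : set path_groupoid) :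
  nbhs t U <-> exists2 a, cylinder a t & cylinder a `<=` U.
Proof.
split.
  rewrite nbhsE => -[B [[D' sD <-] [W D'W Wt]] BU].
  have [a _ aW] := sD _ D'W; exists a; rewrite aW //.
  by move=> s Ws; apply: BU; exists W.
move=> [a at_ aU]; rewrite nbhsE; exists (cylinder a) => //; split=> //.
exists [set cylinder a]; first by move=> _ ->; exists a.
by rewrite bigcup_set1.
Qed.

Lemma cylinder_swap a t : cylinder a t <-> cylinder (gpair_swap a) (pginv t).
Proof.
split=> -[/= h1 h2 h3 h4]; split=> //=; try lia.
  by move=> i j /= ij jE; apply/esym/h4 => /=; lia.
by move=> i j /= ij jE; apply/esym/h4 => /=; lia.
Qed.

Lemma pg_inv_continuous : continuous (@ginv path_groupoid).
Proof.
move=> t U /nbhs_path_groupoidP[a ta aU]; apply/nbhs_path_groupoidP.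
exists (gpair_swap a); first by rewrite -(pginvK t); apply/(cylinder_swap a).
move=> s sa; apply: aU.
by move/cylinder_swap: sa; have -> : gpair_swap (gpair_swap a) = a by exact: gpair_eq.
Qed.

Lemma cylinder_mul a b c s t u : gp2 a = gp1 b -> gp1 c = gp1 a ->
  gp2 c = gp2 b -> cylinder a s -> cylinder b t -> pgprod s t u -> cylinder c u.
Proof.
move=> ab ca cb [a1 a2 ka ha] [b1 b2 kb hb] [st us ku ut].
rewrite ab in a2 ka; split; rewrite ?us ?ut ?ca ?cb //; first lia.
move=> i j; rewrite ?ca => ai jE.
have [h hE] : exists h : nat, (h%:Z = i%:Z + plag s)%R.
  by exists `|(i%:Z + plag s)%R|%N; rewrite ka; lia.
rewrite (ha i h ai hE) st.
by apply: hb; lia.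
Qed.

Lemma pg_prod_continuous s t u (U : set path_groupoid) : gprod s t u ->
  nbhs u U -> \forall p \near (s, t), forall v, gprod p.1 p.2 v -> U v.
Proof.
move=> stu /nbhs_path_groupoidP[c cu cU]; have [st us ku ut] := stu.
have [N hN] := ptail s; have [N1 Nk hNs] := hN.
have [M hM] := ptail t; have [M1 Mk hMt] := hM.
pose n := (N + M + `|plag s| + flen (gp1 c))%N.
pose m := `|(n%:Z + plag s)%R|%N.
pose q := `|(m%:Z + plag t)%R|%N.
have mE : (m%:Z = n%:Z + plag s)%R by lia.
have qE : (q%:Z = m%:Z + plag t)%R by lia.
have [a [a1 a2 as_]] := cylinder_take hN (ltac:(lia) : (N <= n)%N) mE.
have [b [b1 b2 bt]] := cylinder_take hM (ltac:(lia) : (M <= m)%N) qE.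
have ab : gp2 a = gp1 b by rewrite a2 b1 st.
have dP : frng (gp1 a) = frng (gp2 b) by rewrite gpairP ab gpairP.
have du : cylinder (GPair dP) u by exact: cylinder_mul ab _ _ as_ bt stu.
exists (cylinder a, cylinder b).
  by split; apply/nbhs_path_groupoidP; [exists a|exists b].
move=> [s' t'] /= [as' bt'] v stv; apply/cU.
apply: (cylinder_sub cu du) => /=; first by rewrite a1 flen_itake; lia.
exact: cylinder_mul ab _ _ as' bt' stv.
Qed.

HB.instance Definition _ :=
  isTopGroupoid.Build path_groupoid pg_inv_continuous pg_prod_continuous.

(* {((x_1, ..., x_n), (y_1, ..., y_(n + k))) : n >= N} for t = (x, k, y) *)
Definition tail_pairs t N : set (graph_semigroup g) :=
  [set u | exists (n m : nat) (r : frng (itake (pleft t) n) = frng (itake (pright t) m)),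
     [/\ (N <= n)%N, (m%:Z = n%:Z + plag t)%R & u = Some (GPair r)]].

End PathGroupoid.

(* Main.v *)
(* A class X of directed sets is determined by the elements of the semigroup
   that lie above it, and the pairs (alpha, beta) above j(x, k, y) are exactly
   those with (x, k, y) in Z(alpha, beta). This gives the injectivity of j and
   its bicontinuity. Continuity of j needs cylinders to be relatively closed:
   a long enough cylinder is contained in or disjoint from a given one.
   A minimal X contains arbitrarily long pairs, because every vertex emits an
   edge; they are pairwise comparable, so they are the initial segments of two
   infinite paths x and y with a constant lag k, and then j(x, k, y) lies under
   X, hence equals X. *)
Require Import Defs.
From mathcomp Require Import all_boot all_order all_algebra.
From mathcomp Require Import all_classical topology.
From mathcomp Require Import zify.
Set Implicit Arguments.
Unset Strict Implicit.
Unset Printing Implicit Defensive.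

Local Open Scope classical_set_scope.

(** * Classes of directed sets determined by the elements above them *)

Section Below.
Local Open Scope group_scope.
Variable S : invSemigroupType.
Implicit Types (a b c : S) (X Y : ugroupoid S).

Lemma below_trans a b X : natle a b -> below a X -> below b X.
Proof. by move=> ab aX; apply: natle_trans aX (point_cls_le ab). Qed.

Lemma below_directed a b X : below a X -> below b X ->
  exists c, [/\ below c X, natle c a & natle c b].
Proof.
elim/dclsW: X => A dA /belowP[a' Aa aa] /belowP[b' Ab bb].
have [c [Ac ca cb]] := dA.2 _ _ Aa Ab.
exists c; split; [by apply/belowP; exists c|exact: natle_trans aa|exact: natle_trans bb].
Qed.

(** A member b of B lies above [[B]], hence above [[A]], and by [belowP] some member of A then lies
    under b. *)
Lemma natle_below X Y : natle X Y <-> forall a, below a Y -> below a X.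
Proof.
split=> [XY a aY|]; first exact: natle_trans XY aY.
elim/dclsW: Y => B dB; elim/dclsW: X => A dA h.
by apply/natle_dcls => b Bb; apply/belowP/h/belowP; exists b.
Qed.

Lemma below_eq X Y : (forall a, below a X <-> below a Y) -> X = Y.
Proof. by move=> h; apply: natle_anti; apply/natle_below => a /h. Qed.

Lemma below_inv a X : below a X^* <-> below a^* X.
Proof.
by rewrite /below /= point_clsV; split=> /natle_inv; rewrite sinvK.
Qed.

Lemma below_mul a X Y : below a (X * Y) <->
  exists b c, [/\ below b X, below c Y & natle (b * c) a].
Proof.
split; last first.
  move=> [b [c [bX cY bca]]]; apply: below_trans bca _.
  by rewrite /below /= point_clsM; exact: natle_mul.
elim/dclsW: X => A dA; elim/dclsW: Y => B dB.
rewrite [_ * _]mul_dcls => /belowP[_ [b Ab [c Bc <-]] bca].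
by exists b, c; split=> //; apply/belowP; [exists b|exists c].
Qed.

Lemma below_point a b : below a (point_cls b) <-> natle b a.
Proof.
split; last exact: point_cls_le.
by move=> /belowP[_ ->].
Qed.

(** The class of o lies under every class, because o lies under every element of S. For graphs this
    makes the nonzero classes those that [None] is not above. *)
Lemma is_least_below (o : S) X : is_least o -> is_least X <-> below o X.
Proof.
move=> lo; split=> [lX|oX Y]; first exact: lX.
apply: (natle_trans oX); apply/natle_below => a _.
exact/below_point/lo.
Qed.

Lemma minimal_prodV X : is_minimal X -> is_minimal (X * X^*).
Proof. by move=> mX; apply: minimal_mul (minimal_inv mX) => //; rewrite sinvK. Qed.

End Below.

(** * The natural order of the graph semigroup *)

Lemma cat_injl (T : Type) (l m n : seq T) : m ++ l = n ++ l -> m = n.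
Proof.
move=> h; have mn : size m = size n.
  by have /(congr1 size)/eqP := h; rewrite !size_cat eqn_add2r => /eqP.
by have := congr1 (take (size m)) h; rewrite take_size_cat // mn take_size_cat.
Qed.

Section Order.
Local Open Scope group_scope.
Variable g : digraph.
Implicit Types (u v : graph_semigroup g) (a b c : gpair g).

(** In the faithful action by partial bijections, [u * v^*] relates p to p' when u and v carry a
    common path to p and to p'. If v extends u, this forces p = p'. *)
Lemma natle_act u v : natle u v <-> forall p q, gs_act u p q -> gs_act v p q.
Proof.
split=> [uv p q|uv].
  rewrite (natle_eql uv) => /gs_act_mul[m [/gs_act_proj[<- _]]] //.
apply: gs_act_inj => p q; split.
  move=> /gs_act_mul[m [um /gs_act_inv vm]]; apply/gs_act_proj; split; last by exists m.
  exact: gs_act_pinj (uv _ _ um) vm.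
move=> /gs_act_proj[<- [m um]]; apply/gs_act_mul; exists m.
by split=> //; apply/gs_act_inv/uv.
Qed.

Lemma is_least_none : is_least (None : graph_semigroup g).
Proof. by move=> u; apply/natle_act. Qed.

Lemma natle_none a : ~ natle (Some a : graph_semigroup g) None.
Proof. by move=> /natle_act/(_ _ _ (gs_act_id a)). Qed.

(** The graph of the action of a arises from the pair a itself by appending paths, so testing that
    one pair suffices. Longer pairs are smaller. *)
Lemma natle_some a b : natle (Some a : graph_semigroup g) (Some b) <->
  exists m, concat (gp1 b) m (gp1 a) /\ concat (gp2 b) m (gp2 a).
Proof.
split=> [/natle_act/(_ _ _ (gs_act_id a))//|[m [m1 m2]]].
apply/natle_act => p q /= [n [n1 n2]].
have [k mk bk] := concatA m1 n1; have [k' mk' bk'] := concatA m2 n2.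
by exists k; split=> //; rewrite (concat_fun mk mk').
Qed.

Lemma flen_concat (p m q : Defs.fpath g) : concat p m q -> flen q = (flen p + flen m)%N.
Proof. by move=> [_ _ e]; rewrite /flen e size_cat. Qed.

Lemma natle_flen a b : natle (Some a : graph_semigroup g) (Some b) ->
  exists n, flen (gp1 a) = (flen (gp1 b) + n)%N /\ flen (gp2 a) = (flen (gp2 b) + n)%N.
Proof.
by move=> /natle_some[m [/flen_concat-> /flen_concat->]]; exists (flen m).
Qed.

(** The first paths of a and b are initial segments of that of c, so the shorter one extends to the
    longer by some k. Cancelling the common end m in the second path of c shows that k also works
    there. *)
Lemma natle_comparable a b c : natle (Some c : graph_semigroup g) (Some a) ->
  natle (Some c : graph_semigroup g) (Some b) ->
  (flen (gp1 b) <= flen (gp1 a))%N -> natle (Some a : graph_semigroup g) (Some b).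
Proof.
move=> /natle_some[m [a1 a2]] /natle_some[n [b1 b2]] ba.
have [k bka] := concat_factor b1 a1 ba; apply/natle_some; exists k; split=> //.
have [kn kmn bkn] := concatA bka a1; rewrite (concat_inj bkn b1) in kmn.
have [_ k2 k3] := kmn; have [c1 c2 c3] := b2; have [d1 d2 d3] := a2.
split; [by rewrite c1 k2|by rewrite -d2|].
apply: (@cat_injl _ (fedges m)).
by rewrite -d3 c3 k3 catA.
Qed.

End Order.

(** * An infinite path from a chain of finite ones *)

Section Paths.
Variable g : digraph.
Implicit Types (p q : Defs.fpath g).

Lemma is_path_nth (e0 : edge g) v l i : is_path v l -> (i.+1 < size l)%N ->
  src (nth e0 l i.+1) = rng (nth e0 l i).
Proof.
elim: l v i => // e l IHl v i [_ pl]; case: i => [|i] /= il; last exact: IHl pl il.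
by case: l pl il {IHl} => // e' l [].
Qed.

Lemma is_path_head (e0 : edge g) v l : is_path v l -> (0 < size l)%N ->
  src (nth e0 l 0) = v.
Proof. by case: l => // e l []. Qed.

Lemma nth_concat (e0 : edge g) p m q i : concat p m q -> (i < flen p)%N ->
  nth e0 (fedges q) i = nth e0 (fedges p) i.
Proof. by move=> [_ _ ->] ip; rewrite nth_cat ip. Qed.

(** Common extensions make any two paths of P agree wherever both have an edge, so the edge at
    position i can be read off any path longer than i. *)
Lemma ipath_of_chain (P : set (Defs.fpath g)) :
  (forall p q, P p -> P q -> exists r m n, concat p m r /\ concat q n r) ->
  (forall M, exists2 p, P p & (M <= flen p)%N) ->
  exists x, forall p, P p -> iprefix p x.
Proof.
move=> chain long.
have /choice[p_ pP] : forall n, exists p, P p /\ (n < flen p)%N.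
  by move=> n; have [p Pp np] := long n.+1; exists p.
(* The default value for [nth], which needs some edge to exist. *)
have [e0 _] : exists e0 : edge g, True.
  by have [_] := pP 0; rewrite /flen; case: fedges => // e l _; exists e.
have agree p q i : P p -> P q -> (i < flen p)%N -> (i < flen q)%N ->
    nth e0 (fedges p) i = nth e0 (fedges q) i.
  move=> Pp Pq ip iq; have [r [m [n [pr qr]]]] := chain _ _ Pp Pq.
  by rewrite -(nth_concat e0 pr ip) -(nth_concat e0 qr iq).
have xP i : src (nth e0 (fedges (p_ i.+1)) i.+1) = rng (nth e0 (fedges (p_ i)) i).
  have [Pi hi] := pP i; have [Pi1 hi1] := pP i.+1.
  rewrite (is_path_nth e0 (Defs.fpathP _) hi1); congr rng.
  by apply: agree => //; exact: ltnW.
exists (IPath xP) => p Pp; apply/iprefixP; apply: fpath_eq => /=.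
  (* The source needs its own argument, since p may be a vertex. *)
  have [P0 h0] := pP 0; rewrite /isrc /ith /= (is_path_head e0 (Defs.fpathP _) h0).
  by have [r [m [n [[_ <- _] [_ <- _]]]]] := chain _ _ Pp P0.
apply: (@eq_from_nth _ e0); rewrite ?size_mkseq // => i ip.
by rewrite nth_mkseq //; have [Pi hi] := pP i; apply: agree.
Qed.

End Paths.

(** * Cylinders and the natural order *)

Section Tails.
Local Open Scope group_scope.
Variable g : digraph.
Implicit Types (s t : path_groupoid g) (a b c : gpair g) (x y : ipath g).
Local Notation Gamma := (graph_semigroup g).

Lemma ishift_subproof x m i : src (iedge x (m + i.+1)) = rng (iedge x (m + i)).
Proof. by rewrite addnS ipathP. Qed.

Definition ishift x m : ipath g := IPath (ishift_subproof x m).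

Lemma concat_itake x m k : concat (itake x m) (itake (ishift x m) k) (itake x (m + k)).
Proof.
split=> //=; first by rewrite frng_itakeS /isrc /ith /= addn0.
by rewrite /mkseq iotaD map_cat add0n -{2}[m]addn0 iotaDl -map_comp.
Qed.

Lemma ipath_eq x y : (forall i, iedge x i = iedge y i) -> x = y.
Proof.
case: x y => [x hx] [y hy] /= /funext xy; case: _ / xy in hy *.
by congr IPath; exact: Prop_irrelevance.
Qed.

(** Beyond b the two paths of t agree up to the lag, so both coordinates of b are prolonged to those
    of a by the same segment. *)
Lemma cylinder_natle a b t : cylinder a t -> cylinder b t ->
  (flen (gp1 b) <= flen (gp1 a))%N -> natle (Some a : Gamma) (Some b).
Proof.
move=> [/iprefixP a1 /iprefixP a2 ka ha] [/iprefixP b1 /iprefixP b2 kb hb] ba.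
apply/natle_some; set x := pleft t in a1 b1 hb; set y := pright t in a2 b2 hb.
set m := flen (gp1 b) in b1 hb ba; set k := (flen (gp1 a) - m)%N.
exists (itake (ishift x m) k); split.
  by rewrite a1 b1 -[flen (gp1 a)](subnKC ba); exact: concat_itake.
have -> : itake (ishift x m) k = itake (ishift y (flen (gp2 b))) k.
  apply: fpath_eq.
    (* Equality of sources, needed even for empty segments, is the common range of the pair b. *)
    by rewrite /= /isrc /ith /= !addn0 -!frng_itakeS -b1 -b2 gpairP.
  apply/eq_mkseq => i /=; apply: (hb (m + i).+1 (flen (gp2 b) + i).+1); lia.
rewrite a2 b2; have -> : flen (gp2 a) = (flen (gp2 b) + k)%N by rewrite /k; lia.
by rewrite flen_itake; exact: concat_itake.
Qed.

(** Between b and a the paths of t agree because both coordinates of a end in the same m; beyond a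
    they agree by membership in the cylinder of a. *)
Lemma natle_cylinder a b t : natle (Some a : Gamma) (Some b) -> cylinder a t -> cylinder b t.
Proof.
move=> /natle_some[m [m1 m2]] [a1 a2 ka ha].
have pre p q r x : concat p q r -> iprefix r x -> iprefix p x.
  move=> pqr rx; apply/iprefixP; apply: fpath_eq.
    by have [_ <- _] := pqr; move/iprefixP: rx => ->.
  have [_ _ e] := pqr; move/iprefixP: rx => /(congr1 (@fedges g)); rewrite e.
  rewrite (flen_concat pqr) /= /mkseq iotaD map_cat => /(congr1 (take (flen p))).
  by rewrite !take_size_cat // size_map size_iota.
have l1 := flen_concat m1; have l2 := flen_concat m2.
split; [exact: pre m1 a1|exact: pre m2 a2|lia|].
move=> i j bi jE; have [ai|ia] := ltnP (flen (gp1 a)) i; first exact: ha.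
(* The same default serves both coordinates, so that only positions inside m remain to be
   compared. *)
have e1 : nth (ith (pleft t) i) (fedges (gp1 a)) i.-1 = ith (pleft t) i.
  by move/iprefixP: a1 => ->; rewrite /= nth_mkseq //; lia.
have e2 : nth (ith (pleft t) i) (fedges (gp2 a)) j.-1 = ith (pright t) j.
  by move/iprefixP: a2 => ->; rewrite /= nth_mkseq //; lia.
rewrite -e1 -e2; have [_ _ ->] := m1; have [_ _ ->] := m2; rewrite !nth_cat.
rewrite ltnNge -/(flen (gp1 b)) ifF; last by apply/negbTE; lia.
rewrite -/(flen (gp2 b)) ifF; last by apply/negbTE; lia.
by congr nth; lia.
Qed.

(** * The class of the tail pairs: independence of the bound, minimality, injectivity *)

Lemma tail_pairsP t N (u : Gamma) :
  tail_bound N (plag t) (pleft t) (pright t) ->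
  tail_pairs t N u <->
    exists a, [/\ u = Some a, cylinder a t & (N <= flen (gp1 a))%N].
Proof.
move=> hN; split.
  move=> [n [m [r [Nn mE ->]]]]; exists (GPair r); split=> //=; last by rewrite flen_itake.
  have [a [a1 a2]] := cylinder_take hN Nn mE.
  by have -> : a = GPair r by exact: gpair_eq.
move=> [a [-> [/iprefixP a1 /iprefixP a2 ka _] Na]].
have r : frng (itake (pleft t) (flen (gp1 a))) = frng (itake (pright t) (flen (gp2 a))).
  by rewrite -a1 -a2 gpairP.
exists (flen (gp1 a)), (flen (gp2 a)), r; split=> //; first by rewrite ka; lia.
by congr Some; exact: gpair_eq.
Qed.

Lemma tail_pairs_directed t N : tail_bound N (plag t) (pleft t) (pright t) ->
  directed (tail_pairs t N).
Proof.
move=> hN; split.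
  by have [a [at_ Na]] := cylinder_len t N; exists (Some a); apply/(tail_pairsP _ hN); exists a.
move=> _ _ /(tail_pairsP _ hN)[a [-> at_ Na]] /(tail_pairsP _ hN)[b [-> bt Nb]].
have [ab|/ltnW ba] := leqP (flen (gp1 a)) (flen (gp1 b)).
  exists (Some b); split=> //; last exact: cylinder_natle bt at_ ab.
  by apply/(tail_pairsP _ hN); exists b.
exists (Some a); split=> //; last exact: cylinder_natle at_ bt ba.
by apply/(tail_pairsP _ hN); exists a.
Qed.

(** A pair shorter than N still has longer initial pairs of t under it. Since N is absent from the
    right-hand side, all bounds give the same class. *)
Lemma below_tail_pairs t N (dA : directed (tail_pairs t N)) a :
  tail_bound N (plag t) (pleft t) (pright t) ->
  below (Some a : Gamma) (dcls dA) <-> cylinder a t.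
Proof.
move=> hN; rewrite belowP; split.
  by move=> [_ /(tail_pairsP _ hN)[b [-> bt _]] ba]; exact: natle_cylinder ba bt.
move=> at_; have [b [bt bN]] := cylinder_len t (N + flen (gp1 a)).
exists (Some b); last by apply: cylinder_natle bt at_ _; lia.
by apply/(tail_pairsP _ hN); exists b; split=> //; lia.
Qed.

Lemma below_none_tail_pairs t N (dA : directed (tail_pairs t N)) :
  tail_bound N (plag t) (pleft t) (pright t) ->
  ~ below (None : Gamma) (dcls dA).
Proof.
by move=> hN /belowP[_ /(tail_pairsP _ hN)[b [-> _ _]]]; exact: natle_none.
Qed.

(** The bound is picked by choice; [tail_classE] shows the choice to be immaterial. *)
Definition tail_class t : ugroupoid Gamma :=
  dcls (tail_pairs_directed (projT2 (cid (ptail t)))).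

Lemma below_tail_class a t : below (Some a : Gamma) (tail_class t) <-> cylinder a t.
Proof. exact: below_tail_pairs (projT2 (cid (ptail t))). Qed.

Lemma below_none_tail_class t : ~ below (None : Gamma) (tail_class t).
Proof. exact: below_none_tail_pairs (projT2 (cid (ptail t))). Qed.

Lemma tail_classE t N (hN : tail_bound N (plag t) (pleft t) (pright t)) :
  tail_class t = dcls (tail_pairs_directed hN).
Proof.
apply: below_eq => -[a|].
  rewrite below_tail_class; exact: iff_sym (below_tail_pairs _ a hN).
by split=> h; [case: (below_none_tail_class h)|case: (below_none_tail_pairs hN h)].
Qed.

(** Let b lie above a nonzero Y under the class. An initial pair a of t at least as long as b also
    lies above Y, and a nonzero common lower bound makes a and b comparable, so t is in the cylinder
    of b. *)
Lemma minimal_tail_class t : is_minimal (tail_class t).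
Proof.
split; first by move=> /(is_least_below _ (@is_least_none g))/below_none_tail_class.
move=> Y Yt nY; apply: natle_anti => //; apply/natle_below => -[b|] bY; last first.
  by case: nY; apply/(is_least_below _ (@is_least_none g)).
have [a [at_ ba]] := cylinder_len t (flen (gp1 b)).
have aY : below (Some a : Gamma) Y.
  by apply: natle_trans Yt _; apply/below_tail_class.
have [[c|] [cY ca cb]] := below_directed aY bY; last first.
  by case: nY; apply/(is_least_below _ (@is_least_none g)).
apply: below_trans (natle_comparable ca cb ba) _.
exact/below_tail_class.
Qed.

Lemma tail_class_inj : injective tail_class.
Proof.
move=> s t st; have st_edges i :
    [/\ iedge (pleft s) i = iedge (pleft t) i, plag s = plag t &
        iedge (pright s) i = iedge (pright t) i].
  (* Adding the absolute lag makes both coordinates of a longer than i. *)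
  have [a [sa ia]] := cylinder_len s (i.+1 + `|plag s|)%N.
  have ta : cylinder a t by apply/below_tail_class; rewrite -st; apply/below_tail_class.
  case: sa ta => a1 a2 ka _ [b1 b2 kb _]; split.
  - by apply: (iprefix_ith (i := i.+1) a1 b1); lia.
  - by rewrite ka.
  - by apply: (iprefix_ith (i := i.+1) a2 b2); lia.
apply: path_groupoid_eq; first by apply: ipath_eq => i; case: (st_edges i).
  by case: (st_edges 0).
by apply: ipath_eq => i; case: (st_edges i).
Qed.

(** * Compatibility with inverses and products *)

Lemma tail_classV t : tail_class (pginv t) = (tail_class t)^*.
Proof.
apply: below_eq => -[a|]; last first.
  by rewrite below_inv; split=> /below_none_tail_class.
rewrite below_inv below_tail_class (below_tail_class (gpair_swap a)) cylinder_swap.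
by have -> : pginv (pginv t) = t by exact: pginvK.
Qed.

(** Initial pairs of s and t with the same middle path multiply to an initial pair of u. Minimality
    later turns this inequality into an equality. *)
Lemma tail_class_le_mul s t u : pgprod s t u ->
  natle (tail_class u) (tail_class s * tail_class t).
Proof.
move=> stu; apply/natle_below => w /below_mul[a0 [b0 [as_ bt /below_trans abw]]].
apply: abw; case: a0 as_ => [a|/below_none_tail_class//] /below_tail_class as_.
case: b0 bt => [b|/below_none_tail_class//] /below_tail_class bt.
have [N hN] := ptail s; have [N1 Nk _] := hN.
have [M hM] := ptail t; have [M1 Mk _] := hM.
(* Large enough that n and m pass the bounds N and M and the lengths of a and b. *)
pose n := (N + M + `|plag s| + flen (gp1 a) + flen (gp1 b))%N.
pose m := `|(n%:Z + plag s)%R|%N; pose q := `|(m%:Z + plag t)%R|%N.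
have [a' [a1 a2 as']] := cylinder_take hN (ltac:(lia) : (N <= n)%N)
  (ltac:(lia) : (m%:Z = n%:Z + plag s)%R).
have [b' [b1 b2 bt']] := cylinder_take hM (ltac:(lia) : (M <= m)%N)
  (ltac:(lia) : (q%:Z = m%:Z + plag t)%R).
have ab : gp2 a' = gp1 b' by have [st _ _ _] := stu; rewrite a2 b1 st.
have r : frng (gp1 a') = frng (gp2 b') by rewrite gpairP ab gpairP.
have cu : cylinder (GPair r) u by exact: cylinder_mul ab _ _ as' bt' stu.
have abc : gpair_prod a' b' (GPair r).
  left; exists (@FPath g (frng (gp1 a')) [::] I).
  by split=> //; split; rewrite ?gpairP ?ab ?cats0.
apply: (@below_trans _ ((Some a' : Gamma) * (Some b' : Gamma))); last first.
  apply: (@below_trans _ (Some (GPair r) : Gamma)); last exact/below_tail_class.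
  by apply/natle_act => p p' /(gpair_prod_act _ _ abc)/gs_act_mul.
have la : flen (gp1 a') = n by rewrite a1 flen_itake.
have lb : flen (gp1 b') = m by rewrite b1 flen_itake.
by apply: natle_mul; [apply: cylinder_natle as' as_ _|apply: cylinder_natle bt' bt _]; lia.
Qed.

(** Comparable minimal classes coincide. Minimality of a product requires matching idempotents, so
    products of the form r r^{-1}, where this is automatic, are treated first. *)
Lemma tail_classM s t u : pgprod s t u ->
  (tail_class s)^* * tail_class s = tail_class t * (tail_class t)^* /\
  tail_class u = tail_class s * tail_class t.
Proof.
have min_le X Y : is_minimal X -> is_minimal Y -> natle X Y -> X = Y :> ugroupoid Gamma.
  by move=> [nX _] [_ mY] XY; exact: mY.
have prodV r v : pgprod r (pginv r) v -> tail_class v = tail_class r * (tail_class r)^*.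
  move=> rv; apply: min_le; [exact: minimal_tail_class| |].
    by apply: minimal_prodV; exact: minimal_tail_class.
  by rewrite -tail_classV; exact: tail_class_le_mul.
move=> stu; have [st _ _ _] := stu.
have [v tv] : exists v, pgprod t (pginv t) v by exact: pgprod_ex.
have [v' sv] : exists v, pgprod (pginv s) s v by exact: pgprod_ex.
(* Both are the unit at the common middle path. *)
have vv : v = v'.
  case: tv sv => /= _ v1 v2 v3 [/= _ v1' v2' v3'].
  by apply: path_groupoid_eq; rewrite ?v1 ?v2 ?v3 ?v1' ?v2' ?v3' //; lia.
have sv2 : pgprod (pginv s) (pginv (pginv s)) v'.
  by have -> : pginv (pginv s) = s by exact: pginvK.
have e := prodV _ _ sv2; rewrite tail_classV sinvK -vv (prodV _ _ tv) in e.
split=> //; apply: min_le; [exact: minimal_tail_class| |exact: tail_class_le_mul].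
apply: minimal_mul; [by rewrite e|exact: minimal_tail_class..].
Qed.

(** Injectivity turns equal classes of units into equal units; this lets the inverse of j preserve
    products. *)
Lemma tail_class_composable s t :
  (tail_class s)^* * tail_class s = tail_class t * (tail_class t)^* ->
  pright s = pleft t.
Proof.
move=> st; have [v sv] : exists v, pgprod (pginv s) s v by exact: pgprod_ex.
have [v' tv] : exists v, pgprod t (pginv t) v by exact: pgprod_ex.
have vv : v = v'.
  apply: tail_class_inj; rewrite (tail_classM sv).2 (tail_classM tv).2.
  by rewrite !tail_classV.
by case: sv tv => _ _ _ <- [_ _ _ vt]; rewrite vv vt.
Qed.

(** * Every minimal class comes from a pair of infinite paths *)

Section Surjectivity.
Hypothesis s_nonempty : forall v : vertex g, [set e : edge g | src e = v] !=set0.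
Variable X : ugroupoid Gamma.
Hypothesis X_min : is_minimal X.

Lemma minimal_below_none : ~ below (None : Gamma) X.
Proof. by move/(is_least_below _ (@is_least_none g)); case: X_min. Qed.

Lemma minimal_below_directed a b : below (Some a : Gamma) X -> below (Some b : Gamma) X ->
  exists c, [/\ below (Some c : Gamma) X, natle (Some c : Gamma) (Some a) &
                natle (Some c : Gamma) (Some b)].
Proof.
by move=> aX bX; have [[c|] [cX ca cb]] := below_directed aX bX; [exists c|case: minimal_below_none].
Qed.

Lemma gpair_extend a : exists b, natle (Some b : Gamma) (Some a) /\
  flen (gp1 b) = (flen (gp1 a)).+1.
Proof.
have [e se] := s_nonempty (frng (gp1 a)).
have h : is_path (src e) [:: e] by [].
have [p ap] : exists p, concat (gp1 a) (FPath h) p by exact/concat_ex/esym.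
have [q aq] : exists q, concat (gp2 a) (FPath h) q.
  by apply: concat_ex; rewrite -gpairP; exact/esym.
have r : frng p = frng q by rewrite (concat_rng ap) (concat_rng aq).
exists (GPair r); split; first by apply/natle_some; exists (FPath h).
by rewrite /= (flen_concat ap) addn1.
Qed.

(* If the lengths were bounded, a longest pair below X would lie under every
   element of X, and extending it by an edge would give a smaller class. *)
Lemma minimal_unbounded M : exists2 a, below (Some a : Gamma) X & (M <= flen (gp1 a))%N.
Proof.
elim: M => [|M [a aX Ma]].
  have [u uX] : exists u, below u X.
    by elim/dclsW: (X) => A dA; have [[u Au] _] := dA; exists u; apply/belowP; exists u.
  by case: u uX => [a aX|/minimal_below_none//]; exists a.
apply: contrapT => short.
have {}short b : below (Some b : Gamma) X -> (flen (gp1 b) <= M)%N.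
  by move=> bX; rewrite leqNgt; apply/negP => Mb; apply: short; exists b.
have a_least b : below (Some b : Gamma) X -> natle (Some a : Gamma) (Some b).
  move=> bX; have [c [cX ca cb]] := minimal_below_directed aX bX.
  apply: natle_trans cb; apply: natle_comparable ca _ _ => //.
  exact: leq_trans (short _ cX) Ma.
have [b [ba lb]] := gpair_extend a.
have bX : point_cls (Some b : Gamma) = X.
  apply: (proj2 X_min).
    apply/natle_below => -[c /a_least ac|/minimal_below_none//].
    by apply/below_point; exact: natle_trans ba ac.
  by move/(is_least_below _ (@is_least_none g))/below_point/natle_none.
have : below (Some b : Gamma) X by rewrite -bX; apply/below_point.
by move/short; rewrite lb; lia.
Qed.

Lemma tail_class_surj : exists t, tail_class t = X.
Proof.
have [a0 a0X _] := minimal_unbounded 0.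
pose k := ((flen (gp2 a0))%:Z - (flen (gp1 a0))%:Z)%R.
(* Extending a pair keeps its lag, and every pair above X has a common extension with [a0]. *)
have lag a : below (Some a : Gamma) X -> ((flen (gp2 a))%:Z = (flen (gp1 a))%:Z + k)%R.
  move=> aX; have [c [_ /natle_flen[n [h1 h2]] /natle_flen[n' [h1' h2']]]] :=
    minimal_below_directed aX a0X.
  by rewrite /k; lia.
have chain (f : gpair g -> Defs.fpath g) :
    (forall a b, natle (Some a : Gamma) (Some b) -> exists m, concat (f b) m (f a)) ->
    (forall M, exists2 a, below (Some a : Gamma) X & (M <= flen (f a))%N) ->
    exists x, forall a, below (Some a : Gamma) X -> iprefix (f a) x.
  move=> f_natle f_long.
  have [|M|x xP] := @ipath_of_chain g [set f a | a in [set a | below (Some a : Gamma) X]].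
  - move=> _ _ [a aX <-] [b bX <-].
    have [c [cX /f_natle[m ac] /f_natle[n bc]]] := minimal_below_directed aX bX.
    by exists (f c), m, n.
  - by have [a aX Ma] := f_long M; exists (f a) => //; exists a.
  - by exists x => a aX; apply: xP; exists a.
have [a b /natle_some[m [m1 _]]||x xP] := chain (@gp1 g); first by exists m.
  exact: minimal_unbounded.
have [a b /natle_some[m [_ m2]]|M|y yP] := chain (@gp2 g); first by exists m.
  have [a aX Ma] := minimal_unbounded (M + `|k|).
  by exists a => //; have := lag _ aX; lia.
have agree a : below (Some a : Gamma) X -> agree_from (flen (gp1 a)).+1 k x y.
  (* An extension c of a reaching position i follows both coordinates of a by the same m. *)
  move=> aX i j ai jE; have [b bX ib] := minimal_unbounded i.
  have [c [cX cb ca]] := minimal_below_directed bX aX.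
  have ci : (i <= flen (gp1 c))%N by have [n [h _]] := natle_flen cb; lia.
  have [m [m1 m2]] := iffLR (natle_some _ _) ca.
  have := lag _ aX; have := lag _ cX => lc la.
  have e1 : nth (ith x i) (fedges (gp1 c)) i.-1 = ith x i.
    by have /iprefixP-> := xP _ cX; rewrite /= nth_mkseq //; lia.
  have e2 : nth (ith x i) (fedges (gp2 c)) j.-1 = ith y j.
    by have /iprefixP-> := yP _ cX; rewrite /= nth_mkseq //; lia.
  rewrite -e1 -e2; have [_ _ ->] := m1; have [_ _ ->] := m2; rewrite !nth_cat.
  rewrite -/(flen (gp1 a)) ifF; last by apply/negbTE; lia.
  rewrite -/(flen (gp2 a)) ifF; last by apply/negbTE; lia.
  by congr nth; lia.
have xky : tail_equiv k x y.
  by exists (flen (gp1 a0)).+1; split=> //; [have := lag _ a0X; lia|exact: agree].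
exists (PathGroupoid xky); apply: (proj2 X_min).
  apply/natle_below => -[a aX|/minimal_below_none//].
  apply/below_tail_class; split=> /=; [exact: xP|exact: yP| |exact: agree].
  by have := lag _ aX; lia.
by move/(is_least_below _ (@is_least_none g))/below_none_tail_class.
Qed.

End Surjectivity.

(** * Continuity *)

Lemma tail_class_continuous : continuous tail_class.
Proof.
move=> t U /nbhs_ugroupoidP[_ [[u [us [_ ->]]] [tu tus] WU]].
apply/nbhs_path_groupoidP.
case: u tu WU => [a ta|/below_none_tail_class//] WU.
pose len (v : Gamma) := if v is Some c then flen (gp1 c) else 0.
(* The sum bounds the length of a and of every excluded pair at once. *)
have [b [tb lb]] := cylinder_len t (flen (gp1 a) + \sum_(v <- us) len v).
exists b => // s sb; apply: WU; split.
  apply/below_tail_class; apply: (cylinder_sub _ tb) sb; last by lia.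
  exact/below_tail_class.
move=> [c|] cus; last exact: below_none_tail_class.
(* If s were in the excluded cylinder of c, the longer cylinder of b would lie inside it and so
   contain t there. *)
move/below_tail_class => sc; apply: (tus _ cus); apply/below_tail_class.
apply: (cylinder_sub sc sb) tb; apply: leq_trans lb; apply: leq_trans (leq_addl _ _).
by rewrite (big_rem _ cus) /= leq_addr.
Qed.

End Tails.

(** * The isomorphism and its inverse *)

Theorem theorem5 (g : digraph)
  (r_onto : forall v : vertex g, exists e : edge g, rng e = v)
  (s_nonempty : forall v : vertex g, [set e : edge g | src e = v] !=set0)
  (s_finite : forall v : vertex g, finite_set [set e : edge g | src e = v]) :
  exists j : path_groupoid g -> mgroupoid (graph_semigroup g),
    (forall (t : path_groupoid g) (N : nat),
        tail_bound N (plag t) (pleft t) (pright t) ->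
        exists dA : directed (tail_pairs t N), set_val (j t) = dcls dA) /\
    topgroupoid_iso j.
Proof.
pose j (t : path_groupoid g) := mkmin (minimal_tail_class t).
have jE t : set_val (j t) = tail_class t by [].
have j_hom : groupoid_hom j by move=> s t u /tail_classM.
exists j; split=> [t N hN|].
  by exists (tail_pairs_directed hN); rewrite jE (tail_classE hN).
have /choice[j' j'P] : forall X : mgroupoid (graph_semigroup g),
    exists t, set_val X = tail_class t.
  by move=> X; have [t <-] := tail_class_surj s_nonempty (mgroupoidP X); exists t.
have j'K : cancel j' j by move=> X; apply: val_inj; rewrite /= -j'P.
have jK : cancel j j' by move=> t; apply: tail_class_inj; rewrite -j'P.
split=> //.
  move=> t U /nbhs_mgroupoidP[V nV VU].
  have jU : @tail_class g @^-1` V `<=` j @^-1` U by move=> s Vs; exact: (VU (j s) Vs).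
  exact: filterS jU (@tail_class_continuous g t _ nV).
exists j'; split=> //.
  move=> X Y Z XYZ.
  have [XY ZE] := XYZ; rewrite !j'P in XY.
  have [u XYu] := pgprod_ex (tail_class_composable XY).
  (* Both Z and [j u] are the product of X and Y. *)
  have -> : j' Z = u.
    rewrite -(jK u); congr j'; apply: gprod_fun XYZ _.
    by rewrite -(j'K X) -(j'K Y); exact: j_hom.
  exact: XYu.
move=> X U /nbhs_path_groupoidP[a aX aU]; apply/nbhs_mgroupoidP.
(* The preimage of the cylinder of a under [j'] is the trace of the basic open set $U_a$. *)
exists (below (Some a : graph_semigroup g)).
  apply: open_nbhs_nbhs; split; last by rewrite j'P; apply/below_tail_class.
  apply: ubase_open; exists (Some a), [::]; split=> //.
  by apply/seteqP; split=> // Y [].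
by move=> Y; rewrite /= j'P => /below_tail_class/aU.
Qed.
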